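(* Let $(\mathcal F,\mathcal T^X)\in\partial\mathrm{Rat}_{\mathbf F,X}$, let $v$ be a periodic internal vertex, let $t_0\in\mathbb S_v$, and let $B$ be the branch on $v$ (in $T^Y$) attached at $t_0$. Suppose that for every $k\in\mathbb N$, the branch of $T^Y$ on $F^k(v)$ attached at $f_v^k(t_0)$ is mapped by $F$ inside the branch of $T^Z$ on $F^{k+1}(v)$ attached at $f_v^{k+1}(t_0)$. Then: - $B$ does not contain a critical periodic vertex; - if $B$ contains a periodic internal vertex, then the cycle of that vertex has degree $1$ and $t_0$ is periodic (under the maps $f^k$ along the cycle of $v$).
   Context: $\mathbb S$ is the Riemann sphere; $\mathrm{Rat}_d$ is the space of rational maps of degree $d\geq 2$. $X,Y,Z$ are finite sets with at least three elements each and $X\subseteq Y\cap Z$. A portrait $\mathbf F$ of degree $d$ is a pair $(F,\deg)$ with $F:Y\to Z$ and $\deg:Y\to\mathbb N\setminus\{0\}$ such that $\sum_{a\in Y}(\deg(a)-1)=2d-2$ and $\sum_{a\in F^{-1}(b)}\deg(a)=d$ for all $b\in Z$. A tree of spheres $\mathcal T^X$ marked by $X$ consists of a finite tree $T^X$ whose leaves are the elements of $X$ and whose internal (non-leaf) vertices have valence at least $3$, and for each internal vertex $v$ an injection $i_v$ of the set $E_v$ of edges at $v$ into a projective sphere $\mathbb S_v$ (isomorphic to $\mathbb S$). $X_v:=i_v(E_v)$ (similarly $Y_v,Z_v$); $a_v(x):=i_v(e)$ where $e\in E_v$ lies in the same component of $T-\{v\}$ as $x$. $IV^X$ is the set of internal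 vertices. A branch on $v$ is a connected component of $T-\{v\}$ ($T$ regarded as the set of its vertices and edges, so the edges adjacent to $v$ remain); it contains exactly one edge $e\in E_v$ and is said to be attached at the point $i_v(e)\in\mathbb S_v$. A cover $\mathcal F:\mathcal T^Y\to\mathcal T^Z$ consists of a map $F:T^Y\to T^Z$ sending leaves to leaves, internal vertices to internal vertices, edges to edges (compatibly with incidence), and for each internal $v$ with $w=F(v)$ a holomorphic ramified cover $f_v:\mathbb S_v\to\mathbb S_w$ such that $f_v:\mathbb S_v-Y_v\to\mathbb S_w-Z_w$ is a covering, $f_v\circ i_v=i_w\circ F$, and for an edge $e$ between internal vertices $v,v'$ the local degrees of $f_v$ at $i_v(e)$ and of $f_{v'}$ at $i_{v'}(e)$ agree. Its portrait is $F|_Y$ with, for each leaf, the local degree at its adjacent edge. A vertex is critical if it is an internal vertex with $\deg f_v\ge2$ or a leaf of degree at least $2$. $\mathrm{Dyn}_{\mathbf F,X}$ is the set of pairs $(\mathcal F,\mathcal T^X)$ with $\mathcal F:\mathcal T^Y\to\mathcal T^Z$ a cover of portrait $\mathbf F$ and $\mathcal T^X$ a tree of spheres such that each internal vertex $v$ of $T^X$ is an internal vertex of $T^Y$ and $T^Z$, $\mathbb S_v^X=\mathbb S_v^Y=\mathbb S_v^Z$ and $a_v^X=a_v^Y|_X=a_v^Z|_X$. An internal vertex $v$ of $T^X$ is periodic if its iterates lie in $T^X$ and $F^p(v)=v$ for some $p\ge1$; $f_v^k:=f_{F^{k-1}(v)}\circ\dots\circ f_v$; the degree of its cycle (of exact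 period $p$) is $\deg(f_v^p)$. $\mathrm{Rat}_{\mathbf F,X}$ is the set of triples $(f,y,z)$ with $f\in\mathrm{Rat}_d$, injections $y:Y\to\mathbb S$, $z:Z\to\mathbb S$, $f\circ y=z\circ F$ on $Y$, $\deg_{y(a)}f=\deg(a)$ for $a\in Y$, $y|_X=z|_X$. A sequence $(f_n,y_n,z_n)$ in it converges dynamically to $(\mathcal F,\mathcal T^X)$ if there are isomorphisms $\phi^Y_{n,v}:\mathbb S\to\mathbb S_v$ ($v\in IV^Y$), $\phi^Z_{n,w}:\mathbb S\to\mathbb S_w$ ($w\in IV^Z$) with $\phi^Y_{n,v}\circ y_n\to a_v^Y$, $\phi^Z_{n,w}\circ z_n\to a_w^Z$, $\phi^Z_{n,F(v)}\circ f_n\circ(\phi^Y_{n,v})^{-1}\to f_v$ locally uniformly outside $Y_v$ for all $v\in IV^Y$, and $\phi^Y_{n,v}=\phi^Z_{n,v}$ for $v\in IV^X$. $\partial\mathrm{Rat}_{\mathbf F,X}$ is the set of elements of $\mathrm{Dyn}_{\mathbf F,X}$ that are dynamical limits of sequences in $\mathrm{Rat}_{\mathbf F,X}$. *)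

(* Defs.v *)
From HB Require Import structures.
From mathcomp Require Import all_boot all_order all_algebra.
From mathcomp Require Import all_classical all_reals all_analysis.
From mathcomp Require Import complex.
Set Implicit Arguments.
Unset Strict Implicit.
Unset Printing Implicit Defensive.
Import Order.TTheory GRing.Theory Num.Theory.
Import numFieldNormedType.Exports.
Local Open Scope ring_scope.

(* R[i], typed so that it carries its norm and topology. *)
Definition Cplx (R : realType) : numClosedFieldType := R[i].

(* C with a point at infinity, None; its topology and uniform structure are
   pulled back from R^3 by the inverse stereographic projection. *)
Definition rsphere (R : realType) : Type := option (Cplx R).

HB.instance Definition _ (R : realType) := Choice.on (rsphere R).

Definition stereo (R : realType) (s : rsphere R) : R * R * R :=
  match s with
  | Some z =>
      let n := complex.Re z ^+ 2 + complex.Im z ^+ 2 in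
      (2 * complex.Re z / (n + 1), 2 * complex.Im z / (n + 1), (n - 1) / (n + 1))
  | None => (0, 0, 1)
  end.

HB.instance Definition _ (R : realType) :=
  Uniform.copy (rsphere R) (initial_topology (@stereo R)).

Section SphereMaps.
Context {R : realType}.
Local Notation C := (Cplx R).
Local Notation S := (rsphere R).
Local Open Scope classical_set_scope.

(* The map p/q, for coprime p and q. *)
Definition ratmap (p q : {poly C}) (s : S) : S :=
  match s with
  | Some z => if q.[z] == 0 then None else Some (p.[z] / q.[z])
  | None => if (size q < size p)%N then None
            else Some (p`_(size q).-1 / lead_coef q)
  end.

Definition rational_of_degree (d : nat) (f : S -> S) : Prop :=
  exists p q : {poly C},
    [/\ coprimep p q, (maxn (size p) (size q)).-1 = d & f =1 ratmap p q].

(* Local coordinates centred at t: z - a at t = a, and 1/z at t = infinity;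
   loc_point t is the inverse of loc_coord t near t.  The values of loc_coord
   outside the domain of the coordinate are irrelevant. *)
Definition loc_point (t : S) (h : C) : S :=
  match t with
  | Some a => Some (a + h)
  | None => if h == 0 then None else Some h^-1
  end.

Definition loc_coord (t s : S) : C :=
  match t, s with
  | Some a, Some z => z - a
  | None, Some z => z^-1
  | _, None => 0
  end.

Definition loc_expr (f : S -> S) (t : S) (h : C) : C :=
  loc_coord (f t) (f (loc_point t h)).

Definition holomorphic (f : S -> S) : Prop :=
  continuous f /\ forall t : S, derivable (loc_expr f t) 0 1.

(* In local coordinates at t and f t, f is h |-> c h^m (1 + o(1)), c <> 0. *)
Definition local_degree (f : S -> S) (t : S) (m : nat) : Prop :=
  (0 < m)%N /\
  exists2 c : C, c != 0 & (loc_expr f t h / h ^+ m) @[h --> 0^'] --> c.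

(* g : A -> B is a covering map, for open A and B. *)
Definition covering_map (T U : topologicalType) (A : set T) (B : set U)
    (g : T -> U) : Prop :=
  (forall x, A x -> B (g x)) /\
  forall b, B b -> exists N : set U, [/\ open N, N b, N `<=` B &
    exists (I : Type) (W : I -> set T),
      [/\ forall i, open (W i),
          trivIset setT W,
          A `&` g @^-1` N = \bigcup_i W i &
          forall i, exists s : U -> T,
            [/\ {within W i, continuous g}, {within N, continuous s},
                forall x, W i x -> N (g x) /\ s (g x) = x &
                forall y, N y -> W i (s y) /\ g (s y) = y]]].

(* Locally uniform convergence on the open set A. *)
Definition cvg_locally_uniformly (T U : uniformType) (A : set T)
    (gs : nat -> T -> U) (g : T -> U) : Prop :=
  forall t, A t ->
    exists2 N : set T, nbhs t N & {uniform N, gs n @[n --> \oo] --> g}.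

End SphereMaps.

(* The chosen isomorphism with the Riemann sphere only serves to carry the
   structure over; composing it with a Moebius map changes none of the
   notions below. *)
Record projSphere (R : realType) := ProjSphere {
  psort :> Type;
  toS : psort -> rsphere R;
  ofS : rsphere R -> psort;
  toSK : cancel toS ofS;
  ofSK : cancel ofS toS }.

HB.instance Definition _ (R : realType) (P : projSphere R) :=
  gen_eqMixin (psort P).
HB.instance Definition _ (R : realType) (P : projSphere R) :=
  gen_choiceMixin (psort P).
HB.instance Definition _ (R : realType) (P : projSphere R) :=
  Uniform.copy (psort P) (initial_topology (@toS R P)).

Section ProjSphereMaps.
Context {R : realType}.
Local Open Scope classical_set_scope.
Implicit Types P Q : projSphere R.

Definition in_coord P Q (g : P -> Q) : rsphere R -> rsphere R :=
  fun s => toS (g (ofS P s)).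

Definition ramified_cover P Q (g : P -> Q) : Prop :=
  holomorphic (in_coord g) /\ exists s t, g s <> g t.

Definition ps_local_degree P Q (g : P -> Q) (t : P) (m : nat) : Prop :=
  local_degree (in_coord g) (toS t) m.

(* The degree of a ramified cover is the number of points of its generic
   fibres. *)
Definition cover_degree P Q (g : P -> Q) (m : nat) : Prop :=
  exists2 E : set Q, finite_set E &
    forall b, ~ E b -> (g @^-1` [set b] #= `I_m)%card.

Record sphereIso P := SphereIso {
  iso_fun :> rsphere R -> P;
  iso_inv : P -> rsphere R;
  iso_funK : cancel iso_fun iso_inv;
  iso_invK : cancel iso_inv iso_fun;
  iso_moebius : rational_of_degree 1 (fun s => toS (iso_fun s)) }.

End ProjSphereMaps.

(* The vertices of all the trees, hence the marked points, are taken in one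
   finite type V, and Sph v is the sphere attached to v; thus trees sharing an
   internal vertex share its sphere.  Edges are pairs of vertices.  The
   attaching map is only relevant on the edges at an internal vertex. *)
Section Trees.
Context {R : realType} {V : finType} (Sph : V -> projSphere R).

Record sphereTree (X : {set V}) := SphereTree {
  vert : {set V};
  edges : {set {set V}};
  att : forall v, {set V} -> Sph v;
  star := fun v => [set e in edges | v \in e];
  adj := fun u w => (u != w) && ([set u; w] \in edges);
  edges_pair : forall e, e \in edges -> (e \subset vert) /\ #|e| = 2;
  tree_connected : forall u w, u \in vert -> w \in vert -> connect adj u w;
  tree_acyclic : forall s : seq V, (2 < size s)%N -> ~~ ucycleb adj s;
  tree_leaves : [set v in vert | #|star v| == 1%N] = X;
  tree_valence : forall v, v \in vert :\: X -> (3 <= #|star v|)%N;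
  att_inj : forall v, v \in vert :\: X -> {in star v &, injective (att v)} }.

Definition internal X (T : sphereTree X) : {set V} := vert T :\: X.

(* T as the set of its vertices and edges: a vertex u is the cell [set u], an
   edge between u and w is the cell [set u; w]; two cells are incident when
   one is strictly contained in the other. *)
Definition cells X (T : sphereTree X) : {set {set V}} :=
  [set [set u] | u in vert T] :|: edges T.

Definition incident X (T : sphereTree X) (v : V) : rel {set V} :=
  fun c c' => [&& c \in cells T :\ [set v], c' \in cells T :\ [set v]
                & (c \proper c') || (c' \proper c)].

(* The branch on v attached at t, as a set of cells; it is empty when no edge
   at v is attached at t. *)
Definition branch X (T : sphereTree X) (v : V) (t : Sph v) : {set {set V}} :=
  [set c | [exists e in star T v,
              (att T v e == t) && connect (incident T v) e c]].

(* The map a_v: the attaching point of the edge at v leading to x. *)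
Definition attpt X (T : sphereTree X) (v x : V) : Sph v :=
  att T v (odflt finset.set0
    [pick e in star T v | connect (incident T v) e [set x]]).

Definition attset X (T : sphereTree X) (v : V) : set (Sph v) :=
  [set` [pred t | [exists e in star T v, att T v e == t]]]%classic.

End Trees.

Arguments attset {R V Sph X} T v.

Section Dynamics.
Context {R : realType} {V : finType} (Sph : V -> projSphere R).
Variables (d : nat) (X Y Z : {set V}).
Local Open Scope classical_set_scope.

Definition is_portrait (F : V -> V) (dg : V -> nat) : Prop :=
  [/\ forall a, a \in Y -> F a \in Z,
      forall a, a \in Y -> (0 < dg a)%N,
      (\sum_(a in Y) (dg a - 1) = 2 * d - 2)%N &
      forall b, b \in Z -> (\sum_(a in Y | F a == b) dg a = d)%N].

Variables (pF : V -> V) (pdeg : V -> nat).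

Definition RatFX (f : rsphere R -> rsphere R) (y z : V -> rsphere R) : Prop :=
  rational_of_degree d f /\
  [/\ {in Y &, injective y}, {in Z &, injective z},
      forall a, a \in Y -> f (y a) = z (pF a),
      forall a, a \in Y -> local_degree f (y a) (pdeg a) &
      forall a, a \in X -> y a = z a].

Variables (TX : sphereTree Sph X) (TY : sphereTree Sph Y)
          (TZ : sphereTree Sph Z).
(* The tree map on vertices, and the sphere maps; only their values on the
   vertices, resp. internal vertices, of TY are relevant. *)
Variables (F : V -> V) (f : forall v, Sph v -> Sph (F v)).

Record is_cover : Prop := IsCover {
  cover_leaf : forall a, a \in Y -> F a \in Z;
  cover_internal : forall v, v \in internal TY -> F v \in internal TZ;
  cover_edge : forall e, e \in edges TY -> (F @: e)%SET \in edges TZ;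
  cover_ramified : forall v, v \in internal TY -> ramified_cover (@f v);
  cover_covering : forall v, v \in internal TY ->
    covering_map (~` attset TY v) (~` attset TZ (F v)) (@f v);
  cover_att : forall v e, v \in internal TY -> e \in star TY v ->
    f (att TY v e) = att TZ (F v) (F @: e)%SET;
  cover_deg_edge : forall v w e, v \in internal TY -> w \in internal TY ->
    e \in star TY v -> e \in star TY w ->
    exists m, ps_local_degree (@f v) (att TY v e) m /\
              ps_local_degree (@f w) (att TY w e) m }.

Definition has_portrait : Prop :=
  (forall a, a \in Y -> F a = pF a) /\
  (forall a v e, a \in Y -> v \in internal TY ->
     e \in star TY v -> a \in e ->
     ps_local_degree (@f v) (att TY v e) (pdeg a)).

Definition DynFX : Prop :=
  [/\ is_cover, has_portrait,
      (forall v, v \in internal TX ->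
         v \in internal TY /\ v \in internal TZ) &
      (forall v x, v \in internal TX -> x \in X ->
         attpt TX v x = attpt TY v x /\ attpt TX v x = attpt TZ v x)].

Definition dyn_converges (fs : nat -> rsphere R -> rsphere R)
    (ys zs : nat -> V -> rsphere R) : Prop :=
  exists phiY phiZ : nat -> forall v, sphereIso (Sph v),
    [/\ forall v a, v \in internal TY -> a \in Y ->
          phiY n v (ys n a) @[n --> \oo] --> attpt TY v a,
        forall w b, w \in internal TZ -> b \in Z ->
          phiZ n w (zs n b) @[n --> \oo] --> attpt TZ w b,
        forall v, v \in internal TY ->
          cvg_locally_uniformly (~` attset TY v)
            (fun n t => phiZ n (F v) (fs n (iso_inv (phiY n v) t)))
            (@f v) &
        forall n v, v \in internal TX -> phiY n v =1 phiZ n v].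

Definition in_bdRatFX : Prop :=
  DynFX /\
  exists (fs : nat -> rsphere R -> rsphere R) (ys zs : nat -> V -> rsphere R),
    (forall n, RatFX (fs n) (ys n) (zs n)) /\ dyn_converges fs ys zs.

Fixpoint fiter (k : nat) (v : V) : Sph v -> Sph (iter k F v) :=
  match k return Sph v -> Sph (iter k F v) with
  | 0%N => fun t => t
  | k'.+1 => fun t => f (fiter k' t)
  end.

Definition critical_vertex (v : V) : Prop :=
  (v \in internal TY /\
     exists2 m, (2 <= m)%N & cover_degree (@f v) m) \/
  (v \in Y /\ (2 <= pdeg v)%N).

Definition periodic_vertex (v : V) : Prop :=
  [/\ v \in internal TX, forall k, iter k F v \in vert TX &
      exists2 p, (0 < p)%N & iter p F v = v].

Definition exact_period (v : V) (p : nat) : Prop :=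
  [/\ (0 < p)%N, iter p F v = v &
      forall q, (0 < q < p)%N -> iter q F v <> v].

(* Since iter k F v = v only propositionally, f_v^k(t) = t is stated in the
   disjoint union of the spheres. *)
Definition periodic_point (v : V) (t : Sph v) : Prop :=
  exists2 k, (0 < k)%N &
    existT (fun u => psort (Sph u)) (iter k F v) (fiter k t) =
    existT (fun u => psort (Sph u)) v t.

Definition branch_maps_inside (v : V) (t : Sph v) : Prop :=
  forall c, c \in branch TY t -> (F @: c)%SET \in branch TZ (f t).

End Dynamics.

(* Main.v *)
Require Import Defs.
From mathcomp Require Import all_boot all_order all_algebra.
From mathcomp Require Import all_classical all_reals all_analysis.
From mathcomp Require Import complex ring.
Set Implicit Arguments.
Unset Strict Implicit.
Unset Printing Implicit Defensive.
Import Order.TTheory GRing.Theory Num.Theory.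
Import numFieldNormedType.Exports.

(** The orbits of [v] and of a periodic vertex [v'] of the branch have a common
    period. The hypothesis on branches keeps the [k]-th iterate [u'] of [v'] in
    the branch on the [k]-th iterate [u] of [v] attached at [f_v^k (t0)], which
    is thus the direction from [u] to [u']; so [t0] is periodic. (The source and
    target trees agree on this direction because they agree on the leaves of
    [X] that lie behind [u'].)

    It remains to see that the maps [f_u'] have degree 1. For large [n], the
    vertices [u] and [u'] are two scales on the sphere where the rational map
    [f_n] lives: a disk that is tiny at the scale of [u] becomes the plane at
    the scale of [u']. Four marked points of [X] measure this. Send a point [b]
    off the branch to infinity and a point [x] behind [u'] to 0; a third point
    is the unit at the scale of [u], and a fourth one, [w], is the unit at the
    scale of [u']. The coordinate [rho] of [w] at the scale of [u] tends to 0,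
    and the two coordinates differ by the factor [rho]. Let [rho'] be the same
    ratio for the images of [u] and [u'], with its own point [b'].

    The portrait accounts for all preimages of [b'] ([fibre_exhausted]): they
    are marked, and since the branch is mapped inside a branch that does not
    contain [b'] they are all off the branch ([leaf_off_branch]). So in the
    coordinates of [u] the map [f_n] is a quotient [N / D] of polynomials of
    degree at most [d], where [D] is 1 at 0 and has no root near 0. Now [f_n]
    converges at the scale of [u], so that the coefficients of [N] are bounded.
    At the scale of [u'] it also converges; the denominators tend to 1 there,
    and the numerators have the coefficients [N_k * rho ^ k / rho']. These tend
    to the coefficients of a polynomial [T], and [f_u'] is [T] in suitable
    coordinates. If [T_k] is not 0, it follows that [rho' = O(rho ^ k)]. As [T]
    is not constant, [rho' = O(rho)]; if moreover [T] is not affine, then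
    [rho' = O(rho ^ 2)] ([zoom_step]).

    Around the cycle [rho] comes back to itself, which excludes the quadratic
    estimate at every step ([cyclic_scales]). So each [f_u'] is affine in
    suitable coordinates, hence bijective: the cycle of [v'] has degree 1 and
    no vertex of it is critical, periodic vertices being internal.

    The coordinates are cross-ratios. Being invariant under Moebius maps, they
    can be computed on the sphere of [f_n] or on the sphere of a vertex, and
    their continuity turns convergence of marked points into convergence of
    coordinates. Polynomials converge as soon as their values at enough points
    do ([interpolation]), so pointwise convergence of the maps suffices. *)

(** * Directions in a tree of spheres *)

Section Trees.
Context {R : realType} {V : finType} {Sph : V -> projSphere R} {X : {set V}}.
Variable T : sphereTree Sph X.
Implicit Types u v w x : V.
Implicit Types c e : {set V}.

Definition adj_off u : rel V := fun a b => [&& a != u, b != u & adj T a b].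

Lemma adj_sym a b : adj T a b = adj T b a.
Proof. by rewrite /adj eq_sym finset.setUC. Qed.

Lemma adj_off_sym u a b : adj_off u a b = adj_off u b a.
Proof. by rewrite /adj_off adj_sym andbCA. Qed.

Lemma incident_sym u c c' : incident T u c c' = incident T u c' c.
Proof. by rewrite /incident andbCA orbC. Qed.

Lemma adj_vert a b : adj T a b -> (a \in vert T) /\ (b \in vert T).
Proof.
case/andP=> ab /edges_pair [/fintype.subsetP sub _].
by split; apply: sub; rewrite !inE eqxx ?orbT.
Qed.

Lemma set2E e u w : #|e| = 2 -> u \in e -> w \in e -> u != w -> e = [set u; w].
Proof.
move=> ce ue we uw; apply/esym/eqP; rewrite eqEcard ce cards2 uw leqnn andbT.
by apply/fintype.subsetP=> x; rewrite !inE => /orP[] /eqP ->.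
Qed.

Lemma other_end e u : #|e| = 2 -> u \in e -> exists2 w, u != w & e = [set u; w].
Proof.
move=> ce ue; have: #|e :\ u| = 1 by move: ce; rewrite (cardsD1 u) ue; case.
move=> /eqP/cards1P [w Ew]; have we : w \in e :\ u by rewrite Ew inE.
move: we; rewrite !inE => /andP[wu we]; exists w; first by rewrite eq_sym.
by apply: set2E; rewrite // eq_sym.
Qed.

Lemma starP u e : e \in star T u -> exists2 w, e = [set u; w] & adj T u w.
Proof.
rewrite inE => /andP[eT ue]; have [_ ce] := edges_pair eT.
by have [w uw Ee] := other_end ce ue; exists w => //; rewrite /adj uw -Ee.
Qed.

Lemma adj_star u w : adj T u w -> [set u; w] \in star T u.
Proof. by case/andP=> _ eT; rewrite inE eT !inE eqxx. Qed.

Lemma edge_cell a b u : adj T a b ->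
  [set a; b] \in cells T :\ [set u].
Proof.
case/andP=> ab abT; rewrite !inE abT orbT andbT; apply/eqP => E.
have := cards2 a b; rewrite ab E cards1.
by [].
Qed.

Lemma vert_cell a u : a \in vert T -> a != u -> [set a] \in cells T :\ [set u].
Proof.
move=> aT au; rewrite !inE; apply/andP; split.
  by apply: contra au => /eqP /set1_inj ->.
by rewrite imset_f.
Qed.

Lemma incident_edge u a b : adj T a b -> a != u ->
  incident T u [set a] [set a; b].
Proof.
move=> ab au; have [aT bT] := adj_vert ab.
rewrite /incident vert_cell // edge_cell //=; apply/orP; left.
rewrite properEcard cards1 cards2; case/andP: ab => -> _; rewrite andbT.
by apply/fintype.subsetP => x; rewrite !inE => ->.
Qed.

Lemma connect_edge u a b : adj T a b -> b != u ->
  connect (incident T u) [set a; b] [set b].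
Proof.
move=> ab bu; apply: connect1; rewrite incident_sym finset.setUC.
by apply: incident_edge; rewrite // adj_sym.
Qed.

(** A path of incident cells projects to a path of vertices, since an edge is
    entered and left through its ends. *)
Lemma connect_cells u w c c' :
  (forall a, a \in c -> a != u -> connect (adj_off u) w a) ->
  connect (incident T u) c c' ->
  forall a, a \in c' -> a != u -> connect (adj_off u) w a.
Proof.
move=> + /connectP[s]; elim: s c => [|d s IH] c Hc /=; first by move=> _ ->.
move=> /andP[inc ps] Ec'; apply: IH ps Ec' => {s c' } a ad au.
case/and3P: inc => cu du /orP[cd|dc]; last first.
  by apply: Hc => //; apply: fintype.subsetP ad; apply: proper_sub.
move: cu du; rewrite !inE => /andP[cu cT] /andP[_ dT].
have {}dT : d \in edges T.
  case/orP: dT => // /imsetP[b _ Ed]; have := proper_card cd.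
  rewrite Ed cards1 ltnS leqn0 cards_eq0 => /eqP c0; move: cT; rewrite c0.
  by case/orP=> [/imsetP[x _ /setP/(_ x)]|/edges_pair [_]]; rewrite ?inE ?eqxx ?cards0.
have [_ cd2] := edges_pair dT.
case/orP: cT => [/imsetP[b bT Ec]|/edges_pair[_ c2]]; last first.
  by have := proper_card cd; rewrite c2 cd2.
have bu : b != u by apply: contra cu => /eqP <-; rewrite Ec.
have bd : b \in d by apply: (fintype.subsetP (proper_sub cd)); rewrite Ec inE.
have wb : connect (adj_off u) w b by apply: Hc; rewrite ?Ec ?inE.
have [->//|ba] := eqVneq a b.
apply: connect_trans wb (connect1 _); rewrite /adj_off bu au /adj eq_sym ba /=.
by rewrite -(set2E cd2 bd ad) // eq_sym.
Qed.

Definition side u e x := connect (incident T u) e [set x].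

Lemma incident_edge_connect u w s : path (adj T) w s -> u \notin w :: s ->
  w \in vert T ->
  connect (incident T u) [set w] [set last w s].
Proof.
elim: s w => [|b s IH] w //=; rewrite inE => /andP[wb ps] /norP[uw us] wT.
have [_ bT] := adj_vert wb.
have bu : b != u by move: us; rewrite inE negb_or eq_sym => /andP[].
apply: connect_trans (connect1 _) (connect_trans (connect_edge wb bu) (IH b _ _ _)) => //.
by apply: incident_edge; rewrite // eq_sym.
Qed.

Lemma side_exists u x : u \in vert T -> x \in vert T -> x != u ->
  exists2 e, e \in star T u & side u e x.
Proof.
move=> uT xT xu; have /connectP[s ps Ex] := tree_connected uT xT.
case/shortenP: ps Ex => -[|w s'] /=; first by move=> _ _ _ E; rewrite E eqxx in xu.
case/andP=> uw ps /and3P[us _ _] _ Ex; exists [set u; w]; first exact: adj_star.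
have wu : w != u by move: us; rewrite inE negb_or eq_sym => /andP[].
apply: connect_trans (connect_edge uw wu) _; rewrite Ex.
by apply: incident_edge_connect => //; case: (adj_vert uw).
Qed.

(** Two edges at [u] leading to the same vertex would close a cycle
    through [u]. *)
Lemma side_inj u e e' x : e \in star T u -> e' \in star T u -> x != u ->
  side u e x -> side u e' x -> e = e'.
Proof.
move=> /starP[w -> uw] /starP[w' -> uw'] xu sw sw'.
have near b a : adj T u b -> a \in [set u; b] -> a != u -> connect (adj_off u) b a.
  by move=> ub; rewrite !inE => /orP[/eqP-> /eqP//|/eqP-> _]; apply: connect0.
have offsym : connect_sym (adj_off u).
  by apply: sym_connect_sym => a b; rewrite adj_off_sym.
have xin : x \in [set x] by rewrite inE.
have wx : connect (adj_off u) w x.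
  exact: (connect_cells (fun a => near w a uw) sw xin xu).
have w'x : connect (adj_off u) w' x.
  exact: (connect_cells (fun a => near w' a uw') sw' xin xu).
have /connectP[s ps Ew'] : connect (adj_off u) w w'.
  by apply: connect_trans wx _; rewrite offsym.
have [->//|ww'] := eqVneq w w'; case/negP: ww'.
case/shortenP: ps Ew' => s' ps' us' _ Ew'.
case: s' ps' us' Ew' => [|b s'] ps' us' Ew'; first by rewrite Ew'.
have := @tree_acyclic _ _ _ _ T [:: u, w, b & s'] isT.
have uns : u \notin [:: w, b & s'].
  have : all (predC1 u) (w :: b :: s').
    move: (ps'); rewrite /= {1}/adj_off => /andP[/and3P[-> -> _] /=].
    elim: s' (b) {ps' us' Ew'} => //= a s' IH b'.
    by rewrite {1}/adj_off => /andP[/and3P[_ -> _]] /IH.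
  by move=> /allP au; apply/negP => /au /=; rewrite eqxx.
rewrite /ucycleb cons_uniq uns us' andbT => /negP[].
rewrite /= in Ew'; rewrite (cycle_path u) /= -Ew' adj_sym uw' uw /=.
have := @sub_path _ (adj_off u) (adj T) _ w (b :: s') ps'.
by rewrite andbT; apply=> a c /and3P[].
Qed.

Lemma internal_vert u : u \in internal T -> u \in vert T.
Proof. by rewrite inE => /andP[]. Qed.

Lemma attpt_unique u x e : u \in vert T -> x != u -> e \in star T u ->
  side u e x -> attpt T u x = att T u e.
Proof.
move=> uT xu eu ex; rewrite /attpt; case: pickP => [e'|/(_ e)]; last first.
  by rewrite eu -/(side u e x) ex.
by case/andP=> e'u e'x /=; rewrite (side_inj eu e'u xu ex e'x).
Qed.

Lemma attptP u x : u \in vert T -> x \in vert T -> x != u ->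
  exists e, [/\ e \in star T u, side u e x & attpt T u x = att T u e].
Proof.
move=> uT xT xu; have [e eu ex] := side_exists uT xT xu.
by exists e; split => //; apply: attpt_unique.
Qed.

Lemma branch_vertP u (t : Sph u) x : u \in vert T ->
  ([set x] \in branch T t) <-> [/\ x \in vert T, x != u & attpt T u x = t].
Proof.
move=> uT; split=> [|[xT xu <-]]; last first.
  have [e [eu ex ->]] := attptP uT xT xu; rewrite inE; apply/existsP; exists e.
  by rewrite eu eqxx.
rewrite inE => /existsP[e /and3P[eu /eqP Et ex]].
have [xT xu] : x \in vert T /\ x != u.
  have [w Ee uw] := starP eu; move: ex; rewrite Ee.
  case/connectP=> s; elim/last_ind: s => [_ /= E|s c _].
    by case/andP: uw => uw _; have := cards2 u w; rewrite -E cards1 uw.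
  rewrite rcons_path last_rcons => /andP[_ /and3P[_ + _]] Ec; rewrite -{}Ec !inE.
  case/andP=> xu /orP[/imsetP[y yT E]|/edges_pair[_]]; last by rewrite cards1.
  have {y yT E} xT : x \in vert T by rewrite (finset.set1_inj E).
  by split=> //; apply: contra xu => /eqP ->.
by split=> //; rewrite -Et; apply: attpt_unique.
Qed.

(** If [x] lies off the branch of [u'] towards [u], then a path from [u'] to
    [x] avoids [u], so [u] sees [x] and [u'] in the same direction. *)
Lemma attpt_behind u u' x : u \in vert T -> u' \in vert T -> x \in vert T ->
  u != u' -> x != u -> x != u' ->
  attpt T u' x <> attpt T u' u -> attpt T u x = attpt T u u'.
Proof.
move=> uT u'T xT uu' xu xu' ne.
have u'u : u' != u by rewrite eq_sym.
have [e [eu eu' ->]] := attptP uT u'T u'u.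
apply: attpt_unique => //.
have [e' [e'u' e'x E']] := attptP u'T xT xu'.
have e'u : ~~ side u' e' u.
  by apply/negP => e'u; apply: ne; rewrite E'; apply/esym/attpt_unique.
have [w Ee' u'w] := starP e'u'.
have e'Nu : ~~ (u \in e').
  rewrite Ee' !inE negb_or uu' /=; apply: contra e'u => /eqP ->.
  by rewrite Ee'; apply: connect_edge; rewrite // eq_sym; case/andP: u'w.
apply: connect_trans (_ : connect _ _ e') _.
  apply: connect_trans eu' (connect1 _).
  by rewrite Ee'; apply: incident_edge => //; rewrite eq_sym.
have {e'x} : connect (incident T u') e' [set x] by [].
case/connectP=> s ps Ex; apply/connectP; exists s => //.
have off : forall c, c \in e' :: s -> connect (incident T u') e' c.
  move=> c cs; have : c \in e' :: s by [].
  by case/(path_connect ps).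
have cell_off c : c \in e' :: s -> c \in cells T -> c \in cells T :\ [set u].
  move=> cs cT; rewrite finset.in_setD1 cT andbT; apply: contra e'u => /eqP Ec.
  by rewrite /side -Ec; apply: off.
elim: s (e') ps cell_off {Ex off e'Nu e'u e'u' E' Ee'} => //= c s IH c0.
case/andP=> inc ps off; rewrite IH // ?andbT; last first.
  by move=> c1 c1s; apply: off; rewrite inE c1s orbT.
case/and3P: inc => c0T cT sub.
by rewrite /incident sub andbT; apply/andP; split; apply: off;
   rewrite ?inE ?eqxx ?orbT //; move: c0T cT; rewrite !inE => /andP[_ ?] /andP[_ ?].
Qed.

Lemma leaf_vert x : x \in X -> x \in vert T.
Proof. by move=> xX; have := tree_leaves T => /setP /(_ x); rewrite xX inE => /andP[]. Qed.

Lemma leaf_internal_neq x u : x \in X -> u \in internal T -> x != u.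
Proof. by move=> xX; rewrite inE => /andP[uX _]; apply: contraNneq uX => <-. Qed.

(** A longest simple path leaving [u] along [e] ends at a leaf: it could be
    prolonged beyond an internal vertex, since there are no cycles. *)
Lemma leaf_beyond u e : u \in internal T -> e \in star T u ->
  exists2 x, x \in X & attpt T u x = att T u e.
Proof.
move=> uT eu; have [w Ee uw] := starP eu.
pose good n := [exists s : n.-tuple V, path (adj T) u (w :: s) && uniq [:: u, w & s]].
have good0 : exists n, good n.
  exists 0; apply/existsP; exists [tuple]; rewrite /= uw inE /=.
  by case/andP: uw => ->.
have goodub n : good n -> n <= #|V|.
  case/existsP=> s /andP[_ us].
  apply: leq_trans (max_card (mem [:: u, w & s])).
  by rewrite (card_uniqP us) /= size_tuple -addn2 leq_addr.
case: (ex_maxnP good0 goodub) => n /existsP[s /andP[ps us]] maxn.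
pose x := last w s.
have xT : x \in vert T.
  have: all (mem (vert T)) (w :: s).
    move: ps; rewrite /= uw /=; have [_ wT] := adj_vert uw; rewrite wT /=.
    elim: (val s) (w) => //= a s' IH b /andP[ba /IH ->].
    by rewrite andbT; case: (adj_vert ba).
  by move/allP; apply; rewrite /x mem_last.
have xu : x != u.
  move: us => /= /andP[us _]; apply: contra us => /eqP <-.
  exact: mem_last.
exists x; last first.
  rewrite (@attpt_unique u x e) //; first exact: internal_vert.
  rewrite Ee; apply: connect_trans (connect_edge uw _) _.
    by case/andP: uw => + _; rewrite eq_sym.
  apply: incident_edge_connect; first by case/andP: ps.
    by case/andP: us.
  by case: (adj_vert uw).
apply: contraT => xX; have xI : x \in vert T :\: X by rewrite inE xX.
(* all neighbours of x are on the path, hence equal to the last but one vertex *)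
have nb y : adj T x y -> y \in [:: u, w & s].
  move=> xy; apply: contraT => yN.
  have /maxn : good n.+1; last by rewrite ltnn.
  apply/existsP; exists [tuple of rcons s y].
  rewrite -!rcons_cons rcons_path ps rcons_uniq yN us /= andbT.
  by rewrite /= -/x xy.
pose q := belast u (w :: s); have Eq : [:: u, w & s] = rcons q x.
  by rewrite /q /x lastI.
have qlast : forall y, adj T x y -> y = last u (belast w s).
  move=> y xy; have := nb _ xy; rewrite Eq mem_rcons inE => /orP[/eqP E|].
    by move: xy; rewrite E /adj eqxx.
  move=> yq; apply/eqP; apply: contraT => ylast.
  have [q1 [q2 Eq12]] : exists q1 q2, q = q1 ++ y :: q2.
    by case/splitPr: yq => q1 q2; exists q1, q2.
  have q2n : q2 != [::].
    apply: contra ylast => /eqP q20; have := congr1 (last u) Eq12.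
    by rewrite q20 /q /= last_cat /= => ->.
  case: q2 q2n Eq12 => // b q2 _ Eq12.
  have := @tree_acyclic _ _ _ _ T (rcons [:: y, b & q2] x).
  rewrite size_rcons => /(_ isT) /negP []; apply/andP; split; last first.
    have := us; rewrite Eq Eq12 rcons_cat cat_uniq => /and3P[_ _].
    by [].
  have -> : cycle (adj T) (rcons (y :: b :: q2) x) = 
    path (adj T) x (rcons (y :: b :: q2) x).
    by rewrite (cycle_path u) last_rcons.
  rewrite rcons_cons [path _ _ _]/= xy /=.
  have: sorted (adj T) (rcons q x) by rewrite -Eq /=; move: ps.
  by rewrite Eq12 rcons_cat => /cat_sorted2[_].
have : #|star T x| <= 1.
  apply/card_le1_eqP => e1 e2 /starP[a1 -> /qlast ->] /starP[a2 -> /qlast ->].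
  by [].
by have := tree_valence xI; case: #|_| => [|[|]].
Qed.

(** There are three edges at [u], attached at distinct points, and a leaf beyond
    each of them. *)
Lemma leaf_avoiding u (s t : Sph u) : u \in internal T ->
  exists x, [/\ x \in X, attpt T u x <> s & attpt T u x <> t].
Proof.
move=> uI; have v3 := tree_valence uI; have ainj := att_inj uI.
have [e [eu es et]] : exists e, [/\ e \in star T u, att T u e != s & att T u e != t].
  pose A := [set e in star T u | att T u e == s].
  pose B := [set e in star T u | att T u e == t].
  have A1 : #|A| <= 1.
    apply/card_le1_eqP => a b; rewrite !inE => /andP[au /eqP Ea] /andP[bu /eqP Eb].
    by apply: ainj; rewrite ?inE // Ea Eb.
  have B1 : #|B| <= 1.
    apply/card_le1_eqP => a b; rewrite !inE => /andP[au /eqP Ea] /andP[bu /eqP Eb].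
    by apply: ainj; rewrite ?inE // Ea Eb.
  have : 0 < #|star T u :\: (A :|: B)|.
    rewrite cardsD subn_gt0 (leq_ltn_trans _ v3) //.
    apply: leq_trans (_ : #|A :|: B| <= 2); first by rewrite subset_leq_card ?finset.subsetIr.
    by apply: leq_trans (leq_card_setU A B) _; rewrite -[2]/(1+1) leq_add.
  case/card_gt0P=> e; rewrite !inE => /andP[+ eu]; rewrite eu /= negb_or.
  by case/andP=> es et; exists e; split=> //; rewrite inE.
have [x xX Ex] := leaf_beyond uI eu; exists x.
by split=> //; rewrite Ex; apply/eqP.
Qed.

End Trees.

(** * Limits of complex sequences *)

Section Limits.
Context {R : realType}.
Local Notation C := (Cplx R).
Local Open Scope ring_scope.
Local Open Scope classical_set_scope.

Section Filters.
Context {I : Type} {F : set_system I} {FF : Filter F}.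
Implicit Types (u v : I -> C) (a b : C).

Lemma cvg_add u v a b : u i @[i --> F] --> a -> v i @[i --> F] --> b ->
  u i + v i @[i --> F] --> a + b.
Proof. by move=> ua vb; exact (@cvgD C C _ _ FF u v a b ua vb). Qed.

Lemma cvg_mul u v a b : u i @[i --> F] --> a -> v i @[i --> F] --> b ->
  u i * v i @[i --> F] --> a * b.
Proof. by move=> ua vb; exact (@cvgM C _ _ FF u v a b ua vb). Qed.

Lemma cvg_opp u a : u i @[i --> F] --> a -> - u i @[i --> F] --> - a.
Proof. by move=> ua; exact (@cvgN C C _ _ FF u a ua). Qed.

Lemma cvg_sub u v a b : u i @[i --> F] --> a -> v i @[i --> F] --> b ->
  u i - v i @[i --> F] --> a - b.
Proof. by move=> ua vb; exact: (cvg_add ua (cvg_opp vb)). Qed.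

Lemma cvg_inv u a : a != 0 -> u i @[i --> F] --> a ->
  (u i)^-1 @[i --> F] --> a^-1.
Proof. by move=> a0 ua; exact (@cvgV C _ _ FF u a a0 ua). Qed.

Lemma cvg_const a : a @[_ --> F] --> a.
Proof. exact: cvg_cst. Qed.

Lemma cvg_near u v a : (\forall i \near F, u i = v i) ->
  u i @[i --> F] --> a -> v i @[i --> F] --> a.
Proof.
by move=> uv ua; apply: cvg_trans ua; apply: near_eq_cvg.
Qed.

Lemma cvg_exp u a k : u i @[i --> F] --> a -> u i ^+ k @[i --> F] --> a ^+ k.
Proof.
move=> ua; elim: k => [|k IH]; first exact: (@cvg_const 1).
rewrite exprS; under eq_cvg do rewrite exprS.
exact: (cvg_mul ua IH).
Qed.

Lemma cvg_horner (P : {poly C}) u a : u i @[i --> F] --> a ->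
  P.[u i] @[i --> F] --> P.[a].
Proof.
move=> ua; elim/poly_ind: P => [|P c IH].
  by rewrite horner0; under eq_cvg do rewrite horner0; exact: (@cvg_const 0).
rewrite hornerMXaddC; under eq_cvg do rewrite hornerMXaddC.
exact (cvg_add (cvg_mul IH ua) (@cvg_const c)).
Qed.

Lemma cvg_neq0 u a : u i @[i --> F] --> a -> a != 0 ->
  \forall i \near F, u i != 0.
Proof.
move=> ua a0; exact (@cvgr_neq0 C C _ _ FF u a ua a0).
Qed.
End Filters.

Lemma cvg_C_unique {I : Type} {F : set_system I} {FF : ProperFilter F}
    (u : I -> C) (a b : C) :
  u i @[i --> F] --> a -> u i @[i --> F] --> b -> a = b.
Proof.
move=> ua ub; exact (@cvg_unique _ (@norm_hausdorff _ C) _ _ _ _ ua ub).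
Qed.

End Limits.

Arguments cvg_const {R I F FF} a.
Arguments cvg_exp {R I F FF u a} k _.
Arguments cvg_horner {R I F FF} P {u a} _.

(** * Homogeneous coordinates and cross-ratios *)

Section Homogeneous.
Context {R : realType}.
Local Notation C := (Cplx R).
Local Notation S := (rsphere R).
Local Open Scope ring_scope.
Implicit Types p q r s : S.
Implicit Types a b c e : C * C.

Definition hom s : C * C := if s is Some z then (z, 1) else (1, 0).

Definition br a b : C := a.1 * b.2 - b.1 * a.2.

Definition vscale (k : C) a : C * C := (k * a.1, k * a.2).

Lemma vscale1 a : vscale 1 a = a.
Proof. by rewrite /vscale !mul1r -surjective_pairing. Qed.

Lemma br_scale k l a b : br (vscale k a) (vscale l b) = k * l * br a b.
Proof. rewrite /br /=; ring. Qed.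

Lemma br_hom_eq0 p q : (br (hom p) (hom q) == 0) = (p == q).
Proof.
case: p q => [z|] [w|]; rewrite /br /= ?(mulr1, mulr0, mul0r, mul1r, subr0, sub0r).
- rewrite subr_eq0; apply/eqP/eqP => [->//|[]//].
- by rewrite oppr_eq0 oner_eq0; apply/esym/eqP.
- by rewrite oner_eq0; apply/esym/eqP.
- by rewrite eqxx; apply/esym/eqP.
Qed.

Lemma br_homP p q : p <> q -> br (hom p) (hom q) != 0.
Proof. by move=> /eqP; rewrite br_hom_eq0. Qed.

Lemma hom_surj a : a <> (0, 0) -> exists s k, k != 0 /\ hom s = vscale k a.
Proof.
case: a => x y; have [->|y0] := eqVneq y 0 => xy.
  have x0 : x != 0 by apply/eqP => x0; apply: xy; rewrite x0.
  by exists None, x^-1; rewrite invr_eq0 x0 /hom /vscale /= mulVf ?mulr0.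
exists (Some (x / y)), y^-1.
by rewrite invr_eq0 y0 /hom /vscale /= mulVf // mulrC.
Qed.

(** The coordinate of [s] in the chart sending [p], [q], [r] to infinity, 0
    and 1; its value at [p] is meaningless. *)
Definition cross (p q r s : C * C) : C :=
  (br s q * br r p) / (br s p * br r q).

Definition cr p q r s : C := cross (hom p) (hom q) (hom r) (hom s).

Lemma cross_br (k kp kq kr ks : C) (p q r s p' q' r' s' : C * C) :
  k != 0 -> kp != 0 -> kq != 0 -> kr != 0 -> ks != 0 ->
  br s' q' = k * ks * kq * br s q -> br r' p' = k * kr * kp * br r p ->
  br s' p' = k * ks * kp * br s p -> br r' q' = k * kr * kq * br r q ->
  cross p' q' r' s' = cross p q r s.
Proof.
move=> k0 kp0 kq0 kr0 ks0; rewrite /cross => -> -> -> ->.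
have m0 : k ^+ 2 * kp * kq * kr * ks != 0 by rewrite !mulf_neq0 // expf_neq0.
rewrite -[RHS](mulr1) -(divff m0) mulf_div; congr (_ / _); ring.
Qed.

Lemma cross_scale (kp kq kr ks : C) (p q r s : C * C) :
  kp != 0 -> kq != 0 -> kr != 0 -> ks != 0 ->
  cross (vscale kp p) (vscale kq q) (vscale kr r) (vscale ks s) =
  cross p q r s.
Proof.
move=> ? ? ? ?; apply: (@cross_br 1 kp kq kr ks); rewrite ?oner_eq0 ?br_scale //;
by rewrite mul1r.
Qed.

Lemma cr_swap p q r s : s <> p -> s <> q -> r <> p -> r <> q ->
  cr p q r s * cr q p r s = 1.
Proof.
move=> /br_homP ? /br_homP ? /br_homP ? /br_homP ?.
by rewrite /cr /cross; field; do !(apply/andP; split).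
Qed.

Lemma cr_inj p q r s s' : p <> q -> r <> p -> r <> q -> s <> p -> s' <> p ->
  cr p q r s = cr p q r s' -> s = s'.
Proof.
move=> /br_homP pq /br_homP rp /br_homP rq /br_homP sp /br_homP s'p.
rewrite /cr /cross => /eqP; rewrite eqr_div ?mulf_neq0 // => /eqP /esym E.
apply/eqP; rewrite -br_hom_eq0.
have k0 : br (hom r) (hom p) * br (hom r) (hom q) * br (hom p) (hom q) != 0.
  by rewrite !mulf_neq0.
apply/eqP; apply: (mulIf k0); rewrite mul0r.
move/eqP: E; rewrite -subr_eq0 => /eqP E; rewrite -[RHS]E /br; ring.
Qed.

(** Two charts with the same infinity and the same 0 differ by a linear factor:
    a change of scale is a mere multiplication. *)
Lemma cr_rescale p q r w s : p <> q -> r <> p -> r <> q -> w <> p -> w <> q ->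
  s <> p -> cr p q w s = cr p q r s / cr p q r w.
Proof.
move=> /br_homP ? /br_homP ? /br_homP ? /br_homP ? /br_homP ? /br_homP ?.
by rewrite /cr /cross; field; do !(apply/andP; split).
Qed.

Lemma cr_eq0 p q r s : p <> q -> r <> p -> r <> q -> s <> p ->
  (cr p q r s == 0) = (s == q).
Proof.
move=> /br_homP ? /br_homP rp /br_homP rq /br_homP sp.
rewrite /cr /cross mulf_eq0 invr_eq0 !mulf_eq0 br_hom_eq0.
by rewrite (negPf rp) (negPf sp) (negPf rq) !orbF.
Qed.

(** The solution of [cr p q r s = z], in homogeneous coordinates. *)
Definition chart_pt p q r (z : C) : C * C :=
  (z * br (hom r) (hom q) * (hom p).1 - br (hom r) (hom p) * (hom q).1,
   z * br (hom r) (hom q) * (hom p).2 - br (hom r) (hom p) * (hom q).2).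

Lemma chart_pt_cr p q r s : p <> q -> r <> p -> r <> q -> s <> p ->
  exists2 k, k != 0 & chart_pt p q r (cr p q r s) = vscale k (hom s).
Proof.
move=> /br_homP pq /br_homP rp /br_homP rq /br_homP sp.
exists (br (hom r) (hom p) * br (hom p) (hom q) / br (hom s) (hom p)).
  by rewrite !mulf_neq0 // invr_eq0.
rewrite /chart_pt /vscale /cr /cross; congr pair.
  transitivity ((br (hom s) (hom q) * br (hom r) (hom p) * (hom p).1 -
     br (hom s) (hom p) * br (hom r) (hom p) * (hom q).1) / br (hom s) (hom p)).
    by field; rewrite rq sp.
  by rewrite [RHS]mulrAC; congr (_ / _); rewrite /br; ring.
transitivity ((br (hom s) (hom q) * br (hom r) (hom p) * (hom p).2 -
     br (hom s) (hom p) * br (hom r) (hom p) * (hom q).2) / br (hom s) (hom p)).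
  by field; rewrite rq sp.
by rewrite [RHS]mulrAC; congr (_ / _); rewrite /br; ring.
Qed.

Lemma cr_surj p q r (z : C) : p <> q -> r <> p -> r <> q ->
  exists2 s, s <> p & cr p q r s = z.
Proof.
move=> /br_homP pq /br_homP rp /br_homP rq.
have Bp : br (chart_pt p q r z) (hom p) =
    br (hom r) (hom p) * br (hom p) (hom q).
  by rewrite /chart_pt /br /=; ring.
have Bq : br (chart_pt p q r z) (hom q) =
    z * br (hom r) (hom q) * br (hom p) (hom q).
  by rewrite /chart_pt /br /=; ring.
have [|s [k [k0 Es]]] := @hom_surj (chart_pt p q r z).
  move=> E; have := mulf_neq0 rp pq.
  by rewrite -Bp E /br /= mul0r mulr0 subrr eqxx.
exists s.
  apply/eqP; rewrite -br_hom_eq0 Es.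
  by rewrite -[X in br _ X]vscale1 br_scale mulr1 Bp !mulf_neq0.
transitivity (cross (hom p) (hom q) (hom r) (chart_pt p q r z)).
  rewrite /cr Es -[X in cross X _ _ _]vscale1 -[X in cross _ X _ _]vscale1.
  by rewrite -[X in cross _ _ X _]vscale1 cross_scale ?oner_eq0.
by rewrite /cross Bp Bq; field; rewrite rp pq rq.
Qed.

(** Evaluation of the degree [d] homogenisation of [P]. *)
Definition heval d (P : {poly C}) a : C :=
  \sum_(i < d.+1) P`_i * a.1 ^+ i * a.2 ^+ (d - i).

Lemma heval_scale d P k a : heval d P (vscale k a) = k ^+ d * heval d P a.
Proof.
rewrite /heval mulr_sumr; apply: eq_bigr => i _ /=.
have id : (i <= d)%N by rewrite -ltnS ltn_ord.
rewrite -[k ^+ d](_ : k ^+ i * k ^+ (d - i) = _) ?exprMn; first ring.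
by rewrite -exprD subnKC.
Qed.

Lemma heval_fin d (P : {poly C}) z : (size P <= d.+1)%N ->
  heval d P (hom (Some z)) = P.[z].
Proof.
move=> sP; rewrite (horner_coef_wide _ sP).
by apply: eq_bigr => i _; rewrite expr1n mulr1.
Qed.

Lemma heval_inf d (P : {poly C}) : heval d P (hom None) = P`_d.
Proof.
rewrite /heval big_ord_recr /= big1 => [|i _]; last first.
  by rewrite expr0n subn_eq0 leqNgt ltn_ord mulr0.
by rewrite add0r subnn expr0 expr1n !mulr1.
Qed.

Lemma rational_heval d f : rational_of_degree d f ->
  exists P Q : {poly C}, forall s, exists2 k, k != 0 &
    (heval d P (hom s), heval d Q (hom s)) = vscale k (hom (f s)).
Proof.
case=> P [Q [cop Ed fE]]; exists P, Q => s; rewrite fE.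
have mPQ : (0 < maxn (size P) (size Q))%N.
  rewrite lt0n; apply/negP => /eqP m0; move: cop.
  have [P0 Q0] : P = 0 /\ Q = 0.
    by split; apply/eqP; rewrite -size_poly_eq0 -leqn0 -m0 ?leq_maxl ?leq_maxr.
  by rewrite P0 Q0 coprimep0 polyC_eqp1 eqxx.
have mE : maxn (size P) (size Q) = d.+1 by rewrite -Ed prednK.
have sP : (size P <= d.+1)%N by rewrite -mE leq_maxl.
have sQ : (size Q <= d.+1)%N by rewrite -mE leq_maxr.
case: s => [z|]; rewrite ?heval_fin ?heval_inf //=.
  have [Qz|Qz] := eqVneq.
    have Pz : P.[z] != 0.
      apply/negP => Pz; have := coprimep_root cop Pz.
      by rewrite Qz eqxx.
    by exists P.[z]; rewrite // Qz /vscale /= mulr1 mulr0.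
  by exists Q.[z]; rewrite // /vscale /= mulr1 mulrC divfK.
have [PQ|QP] := ltnP.
  have sPE : size P = d.+1 by rewrite -mE; apply/esym/maxn_idPl/ltnW.
  exists P`_d.
    rewrite -[d]/(d.+1.-1) -sPE -/(lead_coef P) lead_coef_eq0 -size_poly_gt0.
    by rewrite sPE.
  rewrite [Q`_d]nth_default; last by rewrite -ltnS -sPE.
  by rewrite /vscale /= mulr1 mulr0.
have sQE : size Q = d.+1 by rewrite -mE; apply/esym/maxn_idPr.
have Qd : Q`_d != 0.
  rewrite -[d]/(d.+1.-1) -sQE -/(lead_coef Q) lead_coef_eq0 -size_poly_gt0.
  by rewrite sQE.
exists Q`_d => //.
by rewrite /vscale /lead_coef sQE /= mulr1 mulrC divfK.
Qed.

Lemma heval1 P a : heval 1 P a = P`_1 * a.1 + P`_0 * a.2.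
Proof. by rewrite /heval !big_ord_recr big_ord0 /=; ring. Qed.

(** A Moebius map multiplies the brackets by its determinant, up to the scaling
    of homogeneous coordinates; both cancel in a cross-ratio. *)
Lemma cr_moebius A p q r s : rational_of_degree 1 A -> injective A ->
  cr (A p) (A q) (A r) (A s) = cr p q r s.
Proof.
move=> /rational_heval[P [Q PQ]] Ainj.
have lin (a b : S) (k l : C) : (heval 1 P (hom a), heval 1 Q (hom a)) = vscale k (hom (A a)) ->
  (heval 1 P (hom b), heval 1 Q (hom b)) = vscale l (hom (A b)) ->
  k * l * br (hom (A a)) (hom (A b)) =
    (P`_1 * Q`_0 - P`_0 * Q`_1) * br (hom a) (hom b).
  move=> Ea Eb; rewrite -br_scale -Ea -Eb !heval1 /br /=; ring.
have det0 : P`_1 * Q`_0 - P`_0 * Q`_1 != 0.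
  have [k k0 Ek] := PQ None; have [l l0 El] := PQ (Some 0).
  have := lin _ _ _ _ Ek El; have [->|//] := eqVneq _ 0.
  move=> /eqP; rewrite mul0r !mulf_eq0 (negPf k0) (negPf l0) br_hom_eq0 /=.
  by move=> /eqP /Ainj.
have [kp kp0 Ep] := PQ p; have [kq kq0 Eq] := PQ q.
have [kr kr0 Er] := PQ r; have [ks ks0 Es] := PQ s.
have step (a b : S) (k l : C) : k != 0 -> l != 0 ->
  (heval 1 P (hom a), heval 1 Q (hom a)) = vscale k (hom (A a)) ->
  (heval 1 P (hom b), heval 1 Q (hom b)) = vscale l (hom (A b)) ->
  br (hom (A a)) (hom (A b)) =
    (P`_1 * Q`_0 - P`_0 * Q`_1) * k^-1 * l^-1 * br (hom a) (hom b).
  move=> k0 l0 Ea Eb; apply: (mulfI (mulf_neq0 k0 l0)).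
  by rewrite (lin _ _ _ _ Ea Eb); field; rewrite k0 l0.
apply: (@cross_br _ kp^-1 kq^-1 kr^-1 ks^-1 _ _ _ _ _ _ _ _ det0);
  rewrite ?invr_eq0 //; exact: step.
Qed.

(** The polynomial [z |-> heval d P (chart_pt p q r z)]. *)
Definition chart_poly d (P : {poly C}) p q r : {poly C} :=
  \sum_(i < d.+1) P`_i *:
    (((br (hom r) (hom q) * (hom p).1)%:P * 'X - (br (hom r) (hom p) * (hom q).1)%:P) ^+ i *
     ((br (hom r) (hom q) * (hom p).2)%:P * 'X - (br (hom r) (hom p) * (hom q).2)%:P) ^+ (d - i)).

Lemma chart_polyE d P p q r z :
  (chart_poly d P p q r).[z] = heval d P (chart_pt p q r z).
Proof.
have aff (a b : C) : (a%:P * 'X - b%:P).[z] = z * a - b.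
  by rewrite !hornerE mulrC.
rewrite horner_sum; apply: eq_bigr => i _.
by rewrite hornerZ hornerM !horner_exp !aff -[RHS]mulrA /chart_pt /= !(mulrA z).
Qed.

Lemma size_polyB_leq (P Q : {poly C}) :
  (size (P - Q)%R <= maxn (size P) (size Q))%N.
Proof. by rewrite -(size_polyN Q) size_polyD. Qed.

Lemma size_affine_exp (a b : C) n : (size ((a%:P * 'X - b%:P) ^+ n) <= n.+1)%N.
Proof.
apply: leq_trans (size_poly_exp_leq _ _) _; rewrite ltnS.
rewrite -[X in (_ <= X)%N]mul1n leq_mul2r; apply/orP; right.
rewrite -subn1 leq_subLR addn1; apply: leq_trans (size_polyB_leq _ _) _.
rewrite geq_max (leq_trans (size_polyC_leq1 _)) // andbT mul_polyC.
by apply: leq_trans (size_scale_leq _ _) _; rewrite size_polyX.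
Qed.

Lemma size_chart_poly d P p q r : (size (chart_poly d P p q r) <= d.+1)%N.
Proof.
apply: leq_trans (size_sum _ _ _) _; apply/bigmax_leqP => i _.
apply: leq_trans (size_scale_leq _ _) _.
apply: leq_trans (size_polyMleq _ _) _.
have id : (i <= d)%N by rewrite -ltnS ltn_ord.
rewrite -subn1 leq_subLR.
apply: leq_trans (leq_add (size_affine_exp _ _ _) (size_affine_exp _ _ _)) _.
by rewrite addSn addnS subnKC.
Qed.

(** The two homogeneous coordinates of [f s] are polynomials of degree at most
    [d] in the coordinate of [s], and they never vanish together. *)
Lemma rational_in_charts d f p q r p' q' r' : rational_of_degree d f ->
  p <> q -> r <> p -> r <> q -> p' <> q' -> r' <> p' -> r' <> q' ->
  exists N D : {poly C}, [/\ (size N <= d.+1)%N, (size D <= d.+1)%N &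
    forall s, s <> p ->
      cr p' q' r' (f s) = N.[cr p q r s] / D.[cr p q r s] /\
      (D.[cr p q r s] == 0) = (f s == p')].
Proof.
move=> /rational_heval[P [Q PQ]] pq rp rq p'q' r'p' r'q'.
pose Pc := chart_poly d P p q r; pose Qc := chart_poly d Q p q r.
pose B x := Pc * (hom x).2%:P - Qc * (hom x).1%:P.
have sB x (k : C) : (size (B x * k%:P)%R <= d.+1)%N.
  have scl (T : {poly C}) l : (size T <= d.+1)%N -> (size (T * l%:P)%R <= d.+1)%N.
    by move=> sT; rewrite mulrC mul_polyC (leq_trans (size_scale_leq _ _)).
  apply: (scl); apply: leq_trans (size_polyB_leq _ _) _.
  by rewrite geq_max !scl // size_chart_poly.
exists (B q' * (br (hom r') (hom p'))%:P), (B p' * (br (hom r') (hom q'))%:P).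
split=> // s sp.
have [k k0 Ek] := chart_pt_cr pq rp rq sp; have [l l0 El] := PQ s.
have BE x : (B x).[cr p q r s] = k ^+ d * l * br (hom (f s)) (hom x).
  rewrite /B !(hornerE) !chart_polyE Ek !heval_scale.
  by case: El => -> ->; rewrite /br; ring.
have m0 : k ^+ d * l != 0 by rewrite mulf_neq0 // expf_neq0.
split; last first.
  rewrite hornerM hornerC BE !mulf_eq0 (negPf (br_homP r'q')) orbF.
  by rewrite -(mulf_eq0 (k ^+ d)) (negPf m0) br_hom_eq0.
have cancel (M x y u v : C) : M != 0 -> M * x * y / (M * u * v) = x * y / (u * v).
  by move=> M0; rewrite -(mulrA M x) -(mulrA M u) -mulf_div divff // mul1r.
by rewrite !hornerM !hornerC !BE cancel.
Qed.

End Homogeneous.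

(** * Counting preimages with local degrees *)

Section Preimages.
Context {R : realType}.
Local Notation C := (Cplx R).
Local Notation S := (rsphere R).
Local Open Scope ring_scope.
Local Open Scope classical_set_scope.

Lemma horner_cvg0 (A : {poly C}) : A.[h] @[h --> (0 : C)^'] --> A.[0].
Proof. by apply: cvg_horner; apply: cvg_within_filter; exact: cvg_id. Qed.

Arguments horner_cvg0 A : clear implicits.

(** If the order of vanishing [k] were smaller than [m], then
    [A h / B h = g h / h ^ m * h ^ (m - k)] would tend to 0. *)
Lemma order_le (g : C -> C) (A B : {poly C}) k m (c : C) :
  (forall h, h != 0 -> g h = h ^+ k * (A.[h] / B.[h])) ->
  A.[0] != 0 -> B.[0] != 0 ->
  g h / h ^+ m @[h --> (0 : C)^'] --> c -> (m <= k)%N.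
Proof.
move=> gE A0 B0 gc; rewrite leqNgt; apply/negP => km.
have AB : A.[h] / B.[h] @[h --> (0 : C)^'] --> (A.[0] / B.[0] : C).
  exact: (cvg_mul (horner_cvg0 A) (cvg_inv B0 (horner_cvg0 B))).
have hz : h ^+ (m - k) @[h --> (0 : C)^'] --> (0 : C).
  have := horner_cvg0 ('X^(m - k)); rewrite hornerXn expr0n subn_eq0 leqNgt km /=.
  by under eq_cvg do rewrite hornerXn.
have : A.[h] / B.[h] @[h --> (0 : C)^'] --> (c * 0 : C).
  apply: cvg_near (cvg_mul gc hz); near=> h.
  have h0 : h != 0 by near: h; exact: nbhs_dnbhs_neq.
  rewrite gE //; move: (A.[h] / B.[h]) => x.
  have -> : h ^+ m = h ^+ (m - k) * h ^+ k by rewrite -exprD subnK // ltnW.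
  by field; rewrite !expf_neq0.
rewrite mulr0 => /(cvg_C_unique AB)/eqP.
by rewrite mulf_eq0 invr_eq0 (negPf A0) (negPf B0).
Unshelve. all: by end_near. Qed.

Lemma count_sum_le (T : eqType) (L M : seq T) : uniq L ->
  (\sum_(s <- L) count_mem s M <= size M)%N.
Proof.
move=> uL; elim: M => [|x M IH] /=; first by rewrite big1.
rewrite big_split /= -add1n leq_add //.
have -> : (\sum_(i <- L) (x == i) = count_mem x L)%N.
  elim: L {uL IH} => [|y L IH]; rewrite ?big_nil // big_cons /= IH.
  by rewrite eq_sym.
by rewrite count_uniq_mem // leq_b1.
Qed.

Lemma prod_split (rs : seq C) (z h : C) :
  \prod_(r <- rs) (z + h - r) =
  h ^+ (count_mem z rs) * (\prod_(r <- rs | r != z) ('X + (z - r)%:P)).[h].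
Proof.
rewrite (bigID (pred1 z)) /= horner_prod; congr (_ * _).
  rewrite (eq_bigr (fun=> h)) ?big_const_seq ?iter_mulr_1 // => r /eqP ->.
  by rewrite addrAC subrr add0r.
by apply: eq_bigr => r _; rewrite hornerD hornerX hornerC addrA [h + z]addrC.
Qed.

Lemma prod_inv (rs : seq C) (h : C) : h != 0 ->
  \prod_(r <- rs) (h^-1 - r) =
  h^-1 ^+ size rs * (\prod_(r <- rs) (1 - r *: 'X)).[h].
Proof.
move=> h0; rewrite horner_prod; elim: rs => [|r rs IH].
  by rewrite !big_nil mulr1.
rewrite !big_cons IH exprS hornerD hornerN hornerZ hornerX hornerC.
have -> : h^-1 - r = h^-1 * (1 - r * h) by field.
by rewrite mulrACA.
Qed.

Lemma monic_factor (T : {poly C}) : T != 0 -> exists rs : seq C,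
  [/\ size T = (size rs).+1,
      forall z, T.[z] = lead_coef T * \prod_(r <- rs) (z - r) &
      forall z, (T.[z] == 0) = (z \in rs)].
Proof.
move=> T0; have [rs Ers] := closed_field_poly_normal T.
have l0 : lead_coef T != 0 by rewrite lead_coef_eq0.
have TE z : T.[z] = lead_coef T * \prod_(r <- rs) (z - r).
  rewrite {1}Ers hornerZ horner_prod; congr (_ * _).
  by apply: eq_bigr => r _; rewrite !hornerE.
exists rs; split => //.
  by rewrite Ers size_scale // size_prod_XsubC.
move=> z; rewrite TE mulf_eq0 (negPf l0) /=.
elim: rs {Ers TE} => [|r rs IH]; first by rewrite big_nil oner_eq0.
by rewrite big_cons mulf_eq0 IH subr_eq0 inE.
Qed.

(** For a map [P / Q], take [T = P - c Q] and [U = Q] when [c] is finite, and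
    [T = Q], [U = P] when it is infinity. *)
Lemma local_quotient d f (c : S) : (0 < d)%N -> rational_of_degree d f ->
  exists T U : {poly C}, [/\ T != 0,
    (size T <= d.+1)%N,
    forall z, f (Some z) = c -> T.[z] = 0 /\ U.[z] != 0,
    f None = c -> (size T <= d)%N /\ size U = d.+1 &
    forall z, loc_coord c (f (Some z)) = T.[z] / U.[z]].
Proof.
move=> d0 [P [Q [cop Ed fE]]].
have mE : maxn (size P) (size Q) = d.+1.
  by rewrite -Ed prednK // lt0n; apply: contraTneq d0 => m0; rewrite -Ed m0.
have sP : (size P <= d.+1)%N by rewrite -mE leq_maxl.
have sQ : (size Q <= d.+1)%N by rewrite -mE leq_maxr.
have PQ0 z : P.[z] = 0 -> Q.[z] != 0 by move=> /eqP; apply: coprimep_root.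
have d1 : d.+1 != 1%N by rewrite eqSS -lt0n.
case: c => [g|].
  exists (P - g *: Q), Q.
  have QgP : (size (P - g *: Q)%R <= d.+1)%N.
    apply: leq_trans (size_polyB_leq _ _) _; rewrite geq_max sP.
    exact: leq_trans (size_scale_leq _ _) _.
  split=> //.
  - apply/eqP => /eqP; rewrite subr_eq0 => /eqP PE.
    move: cop mE; rewrite PE => cop.
    have sQ1 : size Q = 1%N.
      have [g0|g0] := eqVneq g 0; last by move: cop; rewrite coprimepZl // coprimepp => /eqP.
      by move: cop; rewrite g0 scale0r coprime0p => /eqp_size ->; rewrite size_poly1.
    move=> mE; have := size_scale_leq g Q; rewrite sQ1 => sg.
    by move: mE d1; rewrite sQ1 (maxn_idPr sg) => ->; rewrite eqxx.
  - move=> z; rewrite fE /=; case: eqVneq => // Qz [<-].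
    by rewrite !hornerE divfK // subrr.
  - rewrite fE /=; case: ltnP => // QP [Eg].
    have sQE : size Q = d.+1 by rewrite -mE; apply/esym/maxn_idPr.
    split=> //; apply/leq_sizeP => j; rewrite leq_eqVlt => /orP[/eqP <-|dj].
      rewrite coefB coefZ -Eg sQE /= /lead_coef sQE /= divfK ?subrr //.
      rewrite -[d]/(d.+1.-1) -sQE -/(lead_coef Q) lead_coef_eq0 -size_poly_gt0.
      by rewrite sQE.
    by apply: nth_default; apply: leq_trans QgP dj.
  - move=> z; rewrite fE /=; case: eqVneq => [->|Qz]; first by rewrite invr0 mulr0.
    by rewrite !hornerE mulrBl mulfK.
exists Q, P; split=> //.
- apply/eqP => Q0; move: cop; rewrite Q0 coprimep0 => /eqp_size P1.
  rewrite size_poly1 in P1.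
  move: mE; rewrite P1 Q0 size_poly0 maxn0 => E.
  by case/eqP: d1; exact: esym E.
- move=> z; rewrite fE /=; case: eqVneq => // Qz _; split => //.
  by apply/negP => Pz; have := coprimep_root cop Pz; rewrite Qz eqxx.
- rewrite fE /=; case: ltnP => // PQ _.
  have sPE : size P = d.+1 by rewrite -mE; apply/esym/maxn_idPl/ltnW.
  by rewrite -ltnS -sPE.
- move=> z; rewrite fE /=; case: eqVneq => [->|Qz] /=; first by rewrite mul0r.
  by rewrite invf_div.
Qed.

(** A local degree is at most the multiplicity of the corresponding root of the
    numerator [T] of [f] at [c], infinity counting for the defect of the degree
    of [T]; these multiplicities add up to [d]. *)
Lemma fibre_exhausted d f (c : S) (I : finType) (A : {set I}) (y : I -> S)
    (m : I -> nat) : (0 < d)%N -> rational_of_degree d f ->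
  {in A &, injective y} -> (forall a, a \in A -> f (y a) = c) ->
  (forall a, a \in A -> local_degree f (y a) (m a)) ->
  (\sum_(a in A) m a = d)%N ->
  forall s, f s = c -> exists2 a, a \in A & s = y a.
Proof.
move=> d0 fd yinj fy ldeg msum s fs.
have [T [U [T0 sT Tz Tinf TU]]] := local_quotient c d0 fd.
have [rs [sTr TE T0E]] := monic_factor T0.
have l0 : lead_coef T != 0 by rewrite lead_coef_eq0.
(* the fibre of c, with multiplicities *)
pose M : seq S := map Some rs ++ nseq (d - size rs) None.
have rsd : (size rs <= d)%N by rewrite -ltnS -sTr.
have sM : size M = d by rewrite size_cat size_map size_nseq subnKC.
have cM : forall t : S, count_mem t M =
    if t is Some z then count_mem z rs else (d - size rs)%N.
  move=> t; rewrite count_cat count_map; case: t => [z|].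
    rewrite (@eq_count _ (preim _ _) (pred1 z)) //.
    by rewrite (count_nseq) /= mul0n addn0.
  rewrite (@eq_count _ (preim _ _) pred0) // count_pred0 add0n.
  by rewrite count_nseq /= mul1n.
have ordge t k : f t = c -> local_degree f t k -> (k <= count_mem t M)%N.
  move=> ft [k0 [e e0]]; rewrite cM; case: t ft => [z|] ft.
    have [_ Uz] := Tz _ ft.
    apply: (@order_le _ (lead_coef T *: \prod_(r <- rs | r != z) ('X + (z - r)%:P))
      (U \Po ('X + z%:P))).
    - move=> h h0; rewrite /loc_expr ft TU TE prod_split horner_comp hornerZ.
      by rewrite hornerD hornerX hornerC [h + z]addrC mulrCA -[LHS]mulrA.
    - rewrite hornerZ mulf_neq0 // horner_prod prodf_seq_neq0.
      apply/allP => r _; apply/implyP => rz.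
      by rewrite hornerD hornerX hornerC add0r subr_eq0 eq_sym.
    - by rewrite horner_comp hornerD hornerX hornerC add0r.
  have [sTd sUd] := Tinf ft; have U0 : U != 0 by rewrite -size_poly_gt0 sUd.
  have [us [sUu UE _]] := monic_factor U0.
  have lU : lead_coef U != 0 by rewrite lead_coef_eq0.
  have prod0 (ts : seq C) : (\prod_(r <- ts) (1 - r *: 'X)).[0 : C] != 0.
    rewrite horner_prod prodf_seq_neq0; apply/allP => r _; apply/implyP => _.
    by rewrite !hornerE subr0 oner_eq0.
  apply: (@order_le _ (lead_coef T *: \prod_(r <- rs) (1 - r *: 'X))
      (lead_coef U *: \prod_(r <- us) (1 - r *: 'X))).
  - move=> h h0; rewrite /loc_expr ft /= (negPf h0) TU TE UE !prod_inv // !hornerZ.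
    have usd : size us = d by move: sUu; rewrite sUd => -[].
    have -> : h^-1 ^+ size us = h^-1 ^+ (d - size rs) * h^-1 ^+ size rs.
      by rewrite -exprD subnK // usd.
    move: (horner _ _) (horner _ _) => a b; set x := h^-1 ^+ size rs.
    have x0 : x != 0 by rewrite expf_neq0 // invr_eq0.
    transitivity ((x / x) * (h ^+ (d - size rs) *
        (lead_coef T * b / (lead_coef U * a)))); last by rewrite divff // mul1r.
    by rewrite exprVn !invfM invrK; ring.
  - by rewrite hornerZ mulf_neq0.
  - by rewrite hornerZ mulf_neq0.
have sMs : (0 < count_mem s M)%N.
  rewrite cM; case: (s) fs => [z|] fs.
    by rewrite -has_count has_pred1 -T0E; apply/eqP; case: (Tz _ fs).
  by rewrite subn_gt0 -ltnS -sTr ltnS; case: (Tinf fs).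
have [/mapP[a]|sN] := boolP (s \in [seq y a | a <- enum A]).
  by rewrite mem_enum => aA ->; exists a.
have uL : uniq (s :: [seq y a | a <- enum A]).
  rewrite /= sN map_inj_in_uniq ?enum_uniq // => a b.
  by rewrite !mem_enum; apply: yinj.
have := count_sum_le M uL; rewrite sM big_cons big_map big_enum /= leqNgt.
case/negP; rewrite -{1}msum -add1n leq_add //; apply: leq_sum => a aA.
by apply: ordge; [apply: fy|apply: ldeg].
Qed.

End Preimages.

(** * Convergence on the Riemann sphere *)

Section Sphere.
Context {R : realType}.
Local Notation C := (Cplx R).
Local Notation S := (rsphere R).
Local Open Scope ring_scope.
Local Open Scope classical_set_scope.
Implicit Types s t : S.

Lemma cvg_real_C {I : Type} {F : set_system I} {FF : Filter F} (u : I -> R) (a : R) :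
  u i @[i --> F] --> a -> (u i)%:C%C @[i --> F] --> (a%:C%C : C).
Proof.
move=> ua; apply/(@cvgrPdist_lt C C) => e e0.
have [r r0 Er] : exists2 r : R, 0 < r & e = r%:C%C.
  move: e0; rewrite ltcE /= => /andP[/eqP im0 re0].
  by exists (complex.Re e) => //; apply/eqP; rewrite eq_complex /= im0 !eqxx.
move/cvgrPdist_lt: ua => /(_ r r0); apply: filterS => i.
by rewrite Er -rmorphB /= normc_def /= expr0n addr0 sqrtr_sqr ltcR.
Qed.

Definition fin s : C := if s is Some z then z else 0.

Definition sinv s : S :=
  if s is Some z then if z == 0 then None else Some z^-1 else Some 0.

Definition unstereo (w : R * R * R) : C :=
  (w.1.1 / (1 - w.2))%:C%C + 'i%C * (w.1.2 / (1 - w.2))%:C%C.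

Lemma sqn_gt0 (z : C) : 0 < complex.Re z ^+ 2 + complex.Im z ^+ 2 + 1.
Proof. by rewrite ltr_wpDl // addr_ge0 // sqr_ge0. Qed.

Lemma stereoK s : s <> None -> unstereo (stereo s) = fin s.
Proof.
case: s => // z _; rewrite /unstereo /=.
have n0 := lt0r_neq0 (sqn_gt0 z).
move: n0; set x := complex.Re z; set y := complex.Im z => n0.
have e : 1 - (x ^+ 2 + y ^+ 2 - 1) / (x ^+ 2 + y ^+ 2 + 1) =
    2 / (x ^+ 2 + y ^+ 2 + 1) by field.
rewrite e (_ : 2 * x / _ / _ = x); last by field.
rewrite (_ : 2 * y / _ / _ = y); last by field.
by rewrite [RHS]complexE.
Qed.

Lemma stereo_pole s : ((stereo s).2 == 1) = (s == None).
Proof.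
case: s => [z|] /=; last by rewrite !eqxx.
have n0 := lt0r_neq0 (sqn_gt0 z).
apply/negbTE/eqP => /(congr1 (fun x => x * (complex.Re z ^+ 2 + complex.Im z ^+ 2 + 1))).
rewrite divfK // mul1r => /(addrI _) /eqP.
by rewrite -subr_eq0 -opprD oppr_eq0 -mulr2n pnatr_eq0.
Qed.

Lemma stereo_sinv s :
  stereo (sinv s) = ((stereo s).1.1, - (stereo s).1.2, - (stereo s).2).
Proof.
case: s => [z|] /=; last by rewrite /= !(expr0n, mulr0, mul0r, addr0, oppr0, sub0r, add0r, divr1).
have [->|z0] /= := eqVneq z 0.
  by rewrite !(expr0n, mulr0, mul0r, addr0, oppr0, sub0r, add0r, divr1, opprK).
have n0 := lt0r_neq0 (sqn_gt0 z).
have [x [y Ez]] : exists x y, z = (x +i* y)%C by case: (z) => x y; exists x, y.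
move: z0 n0; rewrite Ez eq_complex /= => z0 n0.
have m0 : x ^+ 2 + y ^+ 2 != 0.
  by rewrite paddr_eq0 ?sqr_ge0 // !sqrf_eq0.
have k0 : x ^+ 2 + (- y) ^+ 2 + (x ^+ 2 + y ^+ 2) ^+ 2 != 0.
  rewrite (_ : _ + _ = (x ^+ 2 + y ^+ 2) * (x ^+ 2 + y ^+ 2 + 1)); last by ring.
  by rewrite mulf_neq0.
by congr (_, _, _); field; rewrite m0 n0 k0.
Qed.

Section Filters.
Context {I : Type} {F : set_system I} {FF : Filter F}.
Implicit Types u : I -> S.

Lemma stereo_cvg u t : u i @[i --> F] --> t ->
  stereo (u i) @[i --> F] --> stereo t.
Proof.
move=> ut; have c := @initial_continuous _ _ (@stereo R) t.
exact: (cvg_comp u (@stereo R) ut c).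
Qed.

Lemma cvg_stereo u t : stereo (u i) @[i --> F] --> stereo t ->
  u i @[i --> F] --> t.
Proof.
move=> ut A [B [[W oW <-] Wt]] BA.
have nW : nbhs (stereo t) W := open_nbhs_nbhs (conj oW Wt).
exact: (@filterS _ F FF _ _ (fun i => BA (u i)) (ut _ nW)).
Qed.

Lemma cvg_fst3 (w : I -> R * R * R) (l : R * R * R) : w i @[i --> F] --> l ->
  [/\ (w i).1.1 @[i --> F] --> l.1.1, (w i).1.2 @[i --> F] --> l.1.2 &
      (w i).2 @[i --> F] --> l.2].
Proof.
move=> wl; have w1 : (w i).1 @[i --> F] --> l.1.
  exact: (cvg_comp w fst wl (@cvg_fst _ _ _ _ _)).
split; first exact: (cvg_comp (fst \o w) fst w1 (@cvg_fst _ _ _ _ _)).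
  exact: (cvg_comp (fst \o w) snd w1 (@cvg_snd _ _ _ _ _)).
exact: (cvg_comp w snd wl (@cvg_snd _ _ _ _ _)).
Qed.

Lemma cvg_triple (x y z : I -> R) (a b c : R) : x i @[i --> F] --> a ->
  y i @[i --> F] --> b -> z i @[i --> F] --> c ->
  (x i, y i, z i) @[i --> F] --> (a, b, c).
Proof. by move=> xa yb zc; exact: (cvg_pair (cvg_pair xa yb) zc). Qed.

Lemma cvg_sinv u t : u i @[i --> F] --> t -> sinv (u i) @[i --> F] --> sinv t.
Proof.
move=> /stereo_cvg /cvg_fst3[a b c]; apply: cvg_stereo; rewrite stereo_sinv.
under eq_cvg do rewrite stereo_sinv.
by apply: cvg_triple => //; apply: cvgN.
Qed.

Lemma cvg_fin u t : t <> None -> u i @[i --> F] --> t ->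
  (\forall i \near F, u i <> None) /\ fin (u i) @[i --> F] --> fin t.
Proof.
move=> tN /stereo_cvg /cvg_fst3[a b c].
have t1 : 1 - (stereo t).2 != 0.
  by rewrite subr_eq0 eq_sym stereo_pole; apply/eqP.
have d : 1 - (stereo (u i)).2 @[i --> F] --> 1 - (stereo t).2.
  by apply: cvgB => //; exact: cvg_cst.
have nN : \forall i \near F, u i <> None.
  have : \forall i \near F, 1 - (stereo (u i)).2 != 0 by exact: cvgr_neq0 d t1.
  by apply: filterS => i; rewrite subr_eq0 eq_sym stereo_pole => /eqP.
split => //.
have dV : (1 - (stereo (u i)).2)^-1 @[i --> F] --> (1 - (stereo t).2)^-1.
  exact: cvgV t1 d.
apply: (@cvg_near _ _ _ _ (fun i => unstereo (stereo (u i)))).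
  by apply: filterS nN => i; exact: stereoK.
rewrite -stereoK //.
have x : (stereo (u i)).1.1 / (1 - (stereo (u i)).2) @[i --> F] -->
    (stereo t).1.1 / (1 - (stereo t).2) by exact: cvgM a dV.
have y : (stereo (u i)).1.2 / (1 - (stereo (u i)).2) @[i --> F] -->
    (stereo t).1.2 / (1 - (stereo t).2) by exact: cvgM b dV.
exact: (cvg_add (cvg_real_C x) (cvg_mul (cvg_const 'i%C) (cvg_real_C y))).
Qed.
End Filters.

End Sphere.

Section CrossLimits.
Context {R : realType}.
Local Notation C := (Cplx R).
Local Notation S := (rsphere R).
Local Open Scope ring_scope.
Local Open Scope classical_set_scope.

(** Homogeneous coordinates which are continuous near [t]; [hom] itself is
    not continuous at infinity. *)
Definition lift (t s : S) : C * C :=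
  if t is Some _ then (fin s, 1) else (1, fin (sinv s)).

Lemma lift_hom t s : (if t is Some _ then s <> None else sinv s <> None) ->
  exists2 k, k != 0 & lift t s = vscale k (hom s).
Proof.
case: t s => [w|] [z|] //=; rewrite /lift /vscale /=.
- by exists 1; rewrite ?oner_eq0 // !mul1r.
- case: eqVneq => // z0 _; exists z^-1; rewrite ?invr_eq0 //.
  by rewrite mulVf // mulr1.
- by exists 1; rewrite ?oner_eq0 // mulr1 mulr0.
Qed.

Section Filters.
Context {I : Type} {F : set_system I} {FF : Filter F}.

Lemma cvg_lift (u : I -> S) t : u i @[i --> F] --> t ->
  [/\ (lift t (u i)).1 @[i --> F] --> (lift t t).1,
      (lift t (u i)).2 @[i --> F] --> (lift t t).2 &
      \forall i \near F, exists2 k, k != 0 & lift t (u i) = vscale k (hom (u i))].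
Proof.
case: t => [z|] ut; rewrite /lift /=.
  have zN : (Some z : S) <> None by [].
  have [nN fz] := cvg_fin zN ut.
  split; [exact: fz|exact: cvg_const|].
  by apply: filterS nN => i ui; apply: (@lift_hom (Some z)).
have vt : sinv (u i) @[i --> F] --> (Some 0 : S) by exact: cvg_sinv ut.
have zN : (Some 0 : S) <> None by [].
have [nN f0] := cvg_fin zN vt.
split; [exact: cvg_const|exact: f0|].
by apply: filterS nN => i ui; apply: (@lift_hom None).
Qed.

Lemma cvg_br (a b : I -> C * C) (a0 b0 : C * C) :
  (a i).1 @[i --> F] --> a0.1 -> (a i).2 @[i --> F] --> a0.2 ->
  (b i).1 @[i --> F] --> b0.1 -> (b i).2 @[i --> F] --> b0.2 ->
  br (a i) (b i) @[i --> F] --> br a0 b0.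
Proof.
move=> a1 a2 b1 b2; exact: (cvg_sub (cvg_mul a1 b2) (cvg_mul b1 a2)).
Qed.

(** The coordinates [lift] converge, and they have the same cross-ratios as
    [hom]. *)
Lemma cvg_cr (p q r s : I -> S) (P Q E T : S) : T <> P -> E <> Q ->
  p i @[i --> F] --> P -> q i @[i --> F] --> Q ->
  r i @[i --> F] --> E -> s i @[i --> F] --> T ->
  cr (p i) (q i) (r i) (s i) @[i --> F] --> cr P Q E T.
Proof.
move=> TP EQ /cvg_lift[p1 p2 pk] /cvg_lift[q1 q2 qk].
move=> /cvg_lift[r1 r2 rk] /cvg_lift[s1 s2 sk].
have self (t : S) : exists2 k, k != 0 & lift t t = vscale k (hom t).
  by apply: lift_hom; case: t.
have EC t1 t2 t3 t4 u1 u2 u3 u4 :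
    (exists2 k, k != 0 & lift t1 u1 = vscale k (hom u1)) ->
    (exists2 k, k != 0 & lift t2 u2 = vscale k (hom u2)) ->
    (exists2 k, k != 0 & lift t3 u3 = vscale k (hom u3)) ->
    (exists2 k, k != 0 & lift t4 u4 = vscale k (hom u4)) ->
    cross (lift t1 u1) (lift t2 u2) (lift t3 u3) (lift t4 u4) =
    cr u1 u2 u3 u4.
  move=> [k1 ? ->] [k2 ? ->] [k3 ? ->] [k4 ? ->].
  by rewrite cross_scale.
have nz t1 t2 : t1 <> t2 -> br (lift t1 t1) (lift t2 t2) != 0.
  move=> /br_homP t12; have [k1 ? ->] := self t1; have [k2 ? ->] := self t2.
  by rewrite br_scale !mulf_neq0.
have lim : cross (lift P (p i)) (lift Q (q i)) (lift E (r i)) (lift T (s i))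
    @[i --> F] --> cross (lift P P) (lift Q Q) (lift E E) (lift T T).
  have den : br (lift T T) (lift P P) * br (lift E E) (lift Q Q) != 0.
    by rewrite mulf_neq0 // nz.
  exact: (cvg_mul (cvg_mul (cvg_br s1 s2 q1 q2) (cvg_br r1 r2 p1 p2))
    (cvg_inv den (cvg_mul (cvg_br s1 s2 p1 p2) (cvg_br r1 r2 q1 q2)))).
rewrite (EC _ _ _ _ _ _ _ _ (self P) (self Q) (self E) (self T)) in lim.
apply: cvg_near lim; near=> i; apply: EC; near: i; [exact: pk|exact: qk|exact: rk|exact: sk].
Unshelve. all: by end_near. Qed.
End Filters.

Lemma approach (t : S) : exists2 u : nat -> S, injective u & u n @[n --> \oo] --> t.
Proof.
pose e n : R := n.+1%:R^-1.
have e0 : e n @[n --> \oo] --> (0 : R) by exact: cvg_harmonic.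
have einj : injective e by move=> m n /invr_inj /eqP; rewrite eqr_nat eqSS => /eqP.
have cvgz (z : C) : Some (z + (e n)%:C%C) @[n --> \oo] --> (Some z : S).
  apply: cvg_stereo; case: z => x y /=.
  have xe : x + e n @[n --> \oo] --> x.
    by rewrite -[X in _ --> X]addr0; apply: cvgD => //; exact: cvg_cst.
  have ye : y + 0 @[n --> \oo] --> y by rewrite addr0; exact: cvg_cst.
  have sq : (x + e n) ^+ 2 + (y + 0) ^+ 2 @[n --> \oo] --> x ^+ 2 + y ^+ 2.
    exact: cvgD (cvgM xe xe) (cvgM ye ye).
  have n0 : x ^+ 2 + y ^+ 2 + 1 != 0 by apply: lt0r_neq0; exact: (sqn_gt0 (x +i* y)%C).
  have dV : ((x + e n) ^+ 2 + (y + 0) ^+ 2 + 1)^-1 @[n --> \oo] --> (x ^+ 2 + y ^+ 2 + 1)^-1.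
    apply: cvgV => //; apply: cvgD => //; exact: cvg_cst.
  apply: cvg_triple.
  - by apply: cvgM => //; apply: cvgM => //; exact: cvg_cst.
  - by apply: cvgM => //; apply: cvgM => //; exact: cvg_cst.
  - by apply: cvgM => //; apply: cvgB => //; exact: cvg_cst.
case: t => [z|].
  exists (fun n => Some (z + (e n)%:C%C)) => // m n [] /addrI [] /einj.
  by [].
exists (fun n => sinv (Some (0 + (e n)%:C%C))).
  have en0 n : (e n)%:C%C != 0 :> C by rewrite eq_complex /= eqxx andbT invr_eq0 pnatr_eq0.
  move=> m n; rewrite !add0r /sinv (negPf (en0 m)) (negPf (en0 n)) => /Some_inj E.
  by have /(congr1 (@complex.Re R)) /einj := @invr_inj C _ _ E.
have -> : (None : S) = sinv (Some 0) by rewrite /sinv eqxx.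
exact: cvg_sinv (cvgz 0).
Qed.

End CrossLimits.

(** * Families of polynomials of bounded degree *)

Section Polynomials.
Context {R : realType}.
Local Notation C := (Cplx R).
Local Open Scope ring_scope.
Local Open Scope classical_set_scope.

(** Newton interpolation: dividing by ['X - z_0] lowers the degree, and the
    values of the quotient at the other nodes are divided differences. The
    class [A] of sequences is left open because bounded sequences are needed
    at the coarse scale and convergent ones at the fine scale. *)
Lemma interpolation (A : (nat -> C) -> Prop) :
  A (fun=> 0) ->
  (forall u v, A u -> A v -> A (fun n => u n - v n)) ->
  (forall u v, A u -> A v -> A (fun n => u n * v n)) ->
  (forall u v, (\forall n \near \oo, u n = v n) -> A u -> A v) ->
  forall N (P : nat -> {poly C}) (z : nat -> nat -> C),
  (forall n, (size (P n) <= N)%N) ->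
  (forall i, A (z i)) ->
  (forall i j, i <> j -> A (fun n => (z i n - z j n)^-1) /\
                         \forall n \near \oo, z i n != z j n) ->
  (forall i, A (fun n => (P n).[z i n])) ->
  forall k, A (fun n => (P n)`_k).
Proof.
move=> A0 Asub Amul Anear; elim=> [|N IH] P z sP Az Asep AP k.
  apply: Anear A0; near=> n.
  by have := sP n; rewrite leqn0 size_poly_eq0 => /eqP ->; rewrite coef0.
pose Q n := P n %/ ('X - (z 0%N n)%:P).
have PE n : P n = Q n * ('X - (z 0%N n)%:P) + (P n).[z 0%N n]%:P.
  by rewrite {1}(divp_eq (P n) ('X - (z 0%N n)%:P)) modp_XsubC.
have AQ : forall k, A (fun n => (Q n)`_k).
  apply: (IH Q (fun i => z i.+1)) => //.
  - by move=> n; rewrite size_divp ?polyXsubC_eq0 // size_XsubC leq_subLR addnC addn1.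
  - by move=> i j ij; apply: Asep => -[].
  move=> i; have [Ainv nz] := Asep i.+1 0%N ltac:(by []).
  apply: (Anear _ _ _ (Amul _ _ (Asub _ _ (AP i.+1) (AP 0%N)) Ainv)).
  near=> n; have zz : z i.+1 n - z 0%N n != 0.
    by rewrite subr_eq0; near: n; exact: nz.
  rewrite [in (P n).[z i.+1 n]]PE hornerD hornerM hornerXsubC hornerC.
  by rewrite addrK mulfK.
have Aadd u v : A u -> A v -> A (fun n => u n + v n).
  move=> Au Av; apply: (Anear _ _ _ (Asub _ _ Au (Asub _ _ A0 Av))).
  by near=> n; rewrite sub0r opprK.
have AMX : A (fun n => (Q n * ('X - (z 0%N n)%:P))`_k).
  have A1 : A (fun n => (Q n * 'X)`_k).
    apply: (Anear (fun n => if k == 0%N then 0 else (Q n)`_k.-1)).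
      by near=> n; rewrite coefMX.
    by case: eqP.
  apply: (Anear _ _ _ (Asub _ _ A1 (Amul _ _ (AQ k) (Az 0%N)))).
  by near=> n; rewrite mulrBr coefB coefMC.
have AC : A (fun n => ((P n).[z 0%N n]%:P)`_k).
  apply: (Anear (fun n => if k == 0%N then (P n).[z 0%N n] else 0)).
    by near=> n; rewrite coefC.
  by case: eqP.
apply: (Anear _ _ _ (Aadd _ _ AMX AC)).
by near=> n; rewrite [in RHS]PE coefD.
Unshelve. all: by end_near. Qed.

(** Each root [r] contributes a factor [1 - w / r], at distance at most
    [M * `|w|] from 1. *)
Lemma far_roots (D : {poly C}) d (M w : C) : 0 <= M -> (size D <= d.+1)%N ->
  D.[0] = 1 -> (forall z, D.[z] = 0 -> `|z^-1| <= M) ->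
  `|D.[w] - 1| <= (1 + M * `|w|) ^+ d - 1.
Proof.
move=> M0 sD D0 Dr.
have Dn0 : D != 0 by apply: contra_eq_neq D0 => ->; rewrite horner0 eq_sym oner_eq0.
have [rs [sDr DE D0E]] := monic_factor Dn0.
have rs0 r : r \in rs -> r != 0.
  by move=> rrs; apply: contraTneq rrs => ->; rewrite -D0E D0 oner_eq0.
have rsM r : r \in rs -> `|r^-1| <= M.
  by rewrite -D0E => /eqP; apply: Dr.
have DwE : D.[w] = \prod_(r <- rs) (1 - w * r^-1).
  rewrite -[LHS]divr1 -[X in _ / X]D0 !DE.
  have l0 : lead_coef D != 0 by rewrite lead_coef_eq0.
  rewrite -mulf_div divff // mul1r -prodf_div; apply: eq_big_seq => r /rs0 r0.
  by rewrite sub0r invrN mulrN mulrBl divff // opprB.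
have x0 : 0 <= M * `|w| by rewrite mulr_ge0.
have x1 : 1 <= 1 + M * `|w| by rewrite lerDl.
have step : `|\prod_(r <- rs) (1 - w * r^-1) - 1| <= (1 + M * `|w|) ^+ size rs - 1.
  elim: (rs) rsM => [|r ts IH] rM; first by rewrite big_nil !subrr normr0.
  have {}IH : `|\prod_(r <- ts) (1 - w * r^-1) - 1| <= (1 + M * `|w|) ^+ size ts - 1.
    by apply: IH => s sts; apply: rM; rewrite inE sts orbT.
  rewrite big_cons /= exprS; move: IH; set P := \prod_(_ <- _) _.
  set E := _ ^+ size ts => IH.
  have PE : `|P| <= E.
    rewrite -[P](subrK 1); apply: le_trans (ler_normD _ _) _.
    by rewrite normr1 -lerBrDr.
  rewrite (_ : _ - 1 = (P - 1) - w * r^-1 * P); last by ring.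
  apply: le_trans (ler_normB _ _) _.
  rewrite [leRHS](_ : _ = (E - 1) + M * `|w| * E); last by ring.
  apply: lerD => //; rewrite !normrM; apply: ler_pM => //.
  by rewrite mulrC ler_wpM2r // rM // inE eqxx.
rewrite DwE; apply: le_trans step _; rewrite lerD2r.
by apply: ler_weXn2l => //; rewrite -ltnS -sDr.
Qed.

End Polynomials.

(** * Charts moving with a converging sequence of Moebius maps *)

Section Frames.
Context {R : realType}.
Local Notation C := (Cplx R).
Local Notation S := (rsphere R).
Local Open Scope ring_scope.
Local Open Scope classical_set_scope.

Definition bounded_seq (u : nat -> C) : Prop :=
  exists M : C, 0 <= M /\ \forall n \near \oo, `|u n| <= M.

Lemma bounded_seq0 : bounded_seq (fun=> 0).
Proof. by exists 0; split => //; near=> n; rewrite normr0. Unshelve. all: by end_near. Qed.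

Lemma bounded_seqB u v : bounded_seq u -> bounded_seq v ->
  bounded_seq (fun n => u n - v n).
Proof.
move=> [M [M0 uM]] [N [N0 vN]]; exists (M + N); split; first exact: addr_ge0.
near=> n; apply: le_trans (ler_normB _ _) _; apply: lerD; near: n; [exact: uM|exact: vN].
Unshelve. all: by end_near. Qed.

Lemma bounded_seqM u v : bounded_seq u -> bounded_seq v ->
  bounded_seq (fun n => u n * v n).
Proof.
move=> [M [M0 uM]] [N [N0 vN]]; exists (M * N); split; first exact: mulr_ge0.
near=> n; rewrite normrM; apply: ler_pM => //; near: n; [exact: uM|exact: vN].
Unshelve. all: by end_near. Qed.

Lemma bounded_seq_near u v : (\forall n \near \oo, u n = v n) ->
  bounded_seq u -> bounded_seq v.
Proof.
move=> uv [M [M0 uM]]; exists M; split => //.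
by near=> n; have <- : u n = v n; near: n; [exact: uv|exact: uM].
Unshelve. all: by end_near. Qed.

Lemma cvg_bounded_seq u (l : C) : u n @[n --> \oo] --> l -> bounded_seq u.
Proof.
move=> ul; exists (`|l| + 1); split; first by rewrite addr_ge0.
have /(@cvgrPdist_lt C C) /(_ 1 ltr01) := ul; apply: filterS => n dn.
rewrite -[u n](subrK l); apply: le_trans (ler_normD _ _) _.
by rewrite addrC lerD2l distrC ltW.
Qed.

Lemma cvg_squeeze (u v : nat -> C) (l : C) :
  (\forall n \near \oo, `|u n - l| <= v n) -> v n @[n --> \oo] --> (0 : C) ->
  u n @[n --> \oo] --> l.
Proof.
move=> uv v0; apply/(@cvgrPdist_lt C C) => e e0.
have /(@cvgrPdist_lt C C) /(_ e e0) := v0; apply: filterS2 uv => n uvn.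
rewrite sub0r normrN distrC => vn; apply: le_lt_trans (uvn) _.
by apply: le_lt_trans vn; rewrite real_ler_norm // ger0_real // (le_trans _ uvn).
Qed.

Lemma near_distinct {I : Type} {F : set_system I} {FF : Filter F} (u v : I -> S) (a b : S) :
  a <> b -> u i @[i --> F] --> a -> v i @[i --> F] --> b ->
  \forall i \near F, u i <> v i.
Proof.
move=> ab /cvg_lift[u1 u2 uk] /cvg_lift[v1 v2 vk].
have nz : br (lift a a) (lift b b) != 0.
  have self (t : S) : exists2 k, k != 0 & lift t t = vscale k (hom t).
    by apply: lift_hom; case: t.
  have [k1 k10 ->] := self a; have [k2 k20 ->] := self b.
  by rewrite br_scale !mulf_neq0 // br_homP.
have bn := cvg_neq0 (cvg_br u1 u2 v1 v2) nz.
near=> i; have : br (lift a (u i)) (lift b (v i)) != 0 by near: i; exact: bn.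
have [k k0 ->] : exists2 k, k != 0 & lift a (u i) = vscale k (hom (u i)).
  by near: i; exact: uk.
have [l l0 ->] : exists2 k, k != 0 & lift b (v i) = vscale k (hom (v i)).
  by near: i; exact: vk.
by rewrite br_scale !mulf_eq0 !negb_or br_hom_eq0 => /andP[_ /eqP].
Unshelve. all: by end_near. Qed.

Lemma near_neq (A : nat -> S -> S) (s s' : nat -> S) (T T' : S) : T <> T' ->
  A n (s n) @[n --> \oo] --> T -> A n (s' n) @[n --> \oo] --> T' ->
  \forall n \near \oo, s n <> s' n.
Proof.
move=> TT' As As'; apply: filterS (near_distinct TT' As As') => n ne E'.
by apply: ne; rewrite E'.
Qed.

(** The Moebius maps [A n] will be the coordinates of a vertex of a tree, in
    which the marked points of a varying sphere converge; by invariance, the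
    cross-ratios of these points converge too. *)
Record framed (A : nat -> S -> S) (p q r : nat -> S) (P Q E : S) : Prop := Framed {
  frame_moebius : forall n, rational_of_degree 1 (A n) /\ injective (A n);
  frame_p : A n (p n) @[n --> \oo] --> P;
  frame_q : A n (q n) @[n --> \oo] --> Q;
  frame_r : A n (r n) @[n --> \oo] --> E;
  frame_neq : [/\ P <> Q, E <> P & E <> Q] }.

Lemma framed_swap A p q r P Q E : framed A p q r P Q E -> framed A q p r Q P E.
Proof. by case=> Am Ap Aq Ar [PQ EP EQ]; split => //; split => // /esym. Qed.

Lemma framed_id (P Q E : S) : P <> Q -> E <> P -> E <> Q ->
  framed (fun=> id) (fun=> P) (fun=> Q) (fun=> E) P Q E.
Proof.
move=> PQ EP EQ; split => [_||||] //; try exact: cvg_cst.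
split => //; exists 'X, 1; split; first exact: coprimep1.
  by rewrite size_polyX size_poly1.
case=> [z|] /=; rewrite ?hornerX ?hornerC ?oner_eq0 ?divr1 //.
by rewrite size_polyX size_poly1.
Qed.

Section Framed.
Context {A : nat -> S -> S} {p q r : nat -> S} {P Q E : S}
  (fr : framed A p q r P Q E).

Lemma framed_cvg (s : nat -> S) (T : S) : A n (s n) @[n --> \oo] --> T -> T <> P ->
  cr (p n) (q n) (r n) (s n) @[n --> \oo] --> cr P Q E T.
Proof.
case: fr => Am Ap Aq Ar [PQ EP EQ] As TP.
apply: cvg_near (cvg_cr TP EQ Ap Aq Ar As).
by near=> n; have [d1 inj] := Am n; rewrite cr_moebius.
Unshelve. all: by end_near. Qed.

End Framed.

Section Framed2.
Context {A : nat -> S -> S} {p q r : nat -> S} {P Q E : S}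
  (fr : framed A p q r P Q E).

(** If the points tended to [P], the coordinate where 0 and infinity are
    exchanged would tend to 0, although its product with a convergent sequence
    is 1. *)
Lemma framed_lim (s : nat -> S) (T : S) (l : C) : A n (s n) @[n --> \oo] --> T ->
  (\forall n \near \oo, s n <> p n) ->
  cr (p n) (q n) (r n) (s n) @[n --> \oo] --> l ->
  T <> P /\ cr P Q E T = l.
Proof.
move=> As sp crl; have [Am Ap Aq Ar [PQ EP EQ]] := fr.
have TP : T <> P.
  move=> TP; rewrite TP in As.
  have c0 := framed_cvg (framed_swap fr) As PQ.
  have one : cr (p n) (q n) (r n) (s n) * cr (q n) (p n) (r n) (s n) @[n --> \oo] --> (1 : C).
    apply: (@cvg_near _ _ _ _ (fun=> 1)); last exact: cvg_const.
    have sq := near_neq PQ As Aq; have rp := near_neq EP Ar Ap.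
    have rq := near_neq EQ Ar Aq.
    by near=> n; rewrite cr_swap //; near: n.
  have := cvg_C_unique one (cvg_mul crl c0).
  have -> : cr Q P E P = 0 by apply/eqP; rewrite (cr_eq0 (nesym PQ) EQ EP PQ) eqxx.
  by move=> E'; have := oner_neq0 C; rewrite E' mulr0 eqxx.
by split => //; exact: cvg_C_unique (framed_cvg fr As TP) crl.
Unshelve. all: by end_near. Qed.
End Framed2.

Lemma near_notin (u : nat -> S) (X : set S) : injective u -> finite_set X ->
  \forall n \near \oo, ~ X (u n).
Proof.
move=> uinj fX; have fu : finite_set (u @^-1` X).
  by apply: finite_preimage => // ? ? _ _; exact: uinj.
have /finite_seqP[s Es] := fu.
exists (\max_(i <- s) i).+1 => // n /= Nn Xn.
have : n \in s by have : (u @^-1` X) n := Xn; rewrite Es.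
move=> ns; have : (n <= \max_(i <- s) i)%N by apply: leq_bigmax_seq.
by rewrite leqNgt Nn.
Qed.

(** The points are taken along a sequence that tends to a point where [g] is
    not [c]; being injective, it leaves every finite set. *)
Lemma generic_points (g : S -> S) (X : set S) (c : S) : continuous g ->
  (exists s t, g s <> g t) -> finite_set X ->
  exists2 t : nat -> S, injective t & forall i, ~ X (t i) /\ g (t i) <> c.
Proof.
move=> gc [s0 [t0 st]] fX.
have [t gt] : exists t, g t <> c.
  have [E|//] := pselect (g s0 = c); last by exists s0.
  by exists t0; rewrite -E => /esym.
have [u uinj ut] := approach t.
have gu : g (u n) @[n --> \oo] --> g t by exact: (cvg_comp u g ut (gc t)).
have nc : \forall n \near \oo, g (u n) <> c.
  exact: near_distinct gt gu (cvg_cst c).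
have nX := near_notin uinj fX.
have [N _ Nn] := filterI nc nX.
exists (fun i => u (i + N)%N) => [i j /uinj /addIn //|i].
by have [] := Nn (i + N)%N (leq_addl _ _).
Qed.

End Frames.

(** * Maps that are polynomial in charts *)

Section PolynomialMaps.
Context {R : realType}.
Local Notation C := (Cplx R).
Local Notation S := (rsphere R).
Local Open Scope ring_scope.
Local Open Scope classical_set_scope.

Context (h : S -> S) (hc : continuous h) (hn : exists s t, h s <> h t)
  (p q r p' q' r' : S) (pq : p <> q) (rp : r <> p) (rq : r <> q)
  (p'q' : p' <> q') (r'p' : r' <> p') (r'q' : r' <> q').

Definition bijection (T U : Type) (g : T -> U) : Prop :=
  injective g /\ forall s, exists t, g t = s.

Definition given_by (T : {poly C}) (t : S) : Prop :=
  h t <> p' /\ cr p' q' r' (h t) = T.[cr p q r t].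

Context (E : set S) (fE : finite_set E) (T : {poly C})
  (hT : forall t, ~ E t -> t <> p -> given_by T t).

Lemma generic_approach t : exists u : nat -> S, [/\ u n @[n --> \oo] --> t,
    h (u n) @[n --> \oo] --> h t, \forall n \near \oo, u n <> p &
    \forall n \near \oo, given_by T (u n)].
Proof.
have [u uinj ut] := approach t.
have up : \forall n \near \oo, u n <> p by apply: near_notin uinj (finite_set1 p).
exists u; split; [exact: ut|exact: (cvg_comp u h ut (@hc t))|exact: up|].
by apply: filterS2 (near_notin uinj fE) up => n; exact: hT.
Qed.

Let fr := framed_id pq rp rq.
Let fr' := framed_id p'q' r'p' r'q'.

(** The finitely many exceptions are removable, by continuity. *)
Lemma given_everywhere t : t <> p -> given_by T t.
Proof.
move=> tp; have [u [ut hut up uT]] := generic_approach t.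
apply: (framed_lim fr' hut); first by apply: filterS uT => n [].
have el : cr p q r (u n) @[n --> \oo] --> cr p q r t by exact: (framed_cvg fr ut tp).
by apply: cvg_near (cvg_horner T el); apply: filterS uT => n [].
Qed.

(** Where [T] is constant so is [h], and its value at [p] follows by
    continuity. *)
Lemma given_nonconstant : (1 < size T)%N.
Proof.
rewrite ltnNge; apply/negP => /size1_polyC Tc.
have hconst s t : s <> p -> t <> p -> h s = h t.
  move=> /given_everywhere[sp Es] /given_everywhere[tp Et].
  by apply: (cr_inj p'q' r'p' r'q' sp tp); rewrite Es Et Tc !hornerC.
have hq t : h t = h q.
  have [tp|tp] := pselect (t = p); last by apply: hconst => //; exact: nesym.
  apply: contrapT => ne; have [u [ut hut up _]] := generic_approach t.
  have nu : \forall n \near \oo, h (u n) <> h q.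
    exact: (near_distinct ne hut (cvg_cst (h q))).
  have : \forall n \near \oo, False.
    apply: filterS2 nu up => n hn' un; apply: hn'; apply: hconst => //.
    exact: nesym.
  by case=> m _ /(_ m) /=; apply.
by have [s [t]] := hn; rewrite !hq.
Qed.

Lemma given_affine_bijective : size T = 2%N ->
  bijection h.
Proof.
move=> sT; have T1 : T`_1 != 0.
  by rewrite -[1%N]/(2%N.-1) -sT -/(lead_coef T) lead_coef_eq0 -size_poly_gt0 sT.
have TE z : T.[z] = T`_0 + T`_1 * z.
  by rewrite horner_coef sT !big_ord_recl big_ord0 /= expr0 mulr1 expr1 addr0.
(* otherwise T would be bounded along a sequence tending to infinity *)
have hp : h p = p'.
  apply: contrapT => hpp; have [u [ut hut up uT]] := generic_approach p.
  have el' : cr p' q' r' (h (u n)) @[n --> \oo] --> cr p' q' r' (h p).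
    exact: (framed_cvg fr' hut hpp).
  have el : cr p q r (u n) @[n --> \oo] --> ((cr p' q' r' (h p) - T`_0) * (T`_1)^-1 : C).
    have lim : (cr p' q' r' (h (u n)) - T`_0) * (T`_1)^-1 @[n --> \oo] -->
      ((cr p' q' r' (h p) - T`_0) * (T`_1)^-1 : C).
      exact: (cvg_mul (cvg_sub el' (cvg_const _)) (cvg_const _)).
    apply: cvg_near lim; apply: filterS uT => n [_ ->].
    by rewrite TE [T`_0 + _]addrC addrK mulrC mulKf.
  by have [ne _] := framed_lim fr ut up el; apply: ne.
split.
  move=> s t; have [->|sp] := pselect (s = p); have [->//|tp] := pselect (t = p).
  - by rewrite hp => e; have [htp _] := given_everywhere tp; case: htp.
  - by rewrite hp => e; have [hsp _] := given_everywhere sp; case: hsp.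
  move=> e; have [_ Es] := given_everywhere sp; have [_ Et] := given_everywhere tp.
  apply: (cr_inj pq rp rq sp tp); apply: (mulfI T1); apply: (addrI T`_0).
  by rewrite -!TE -Es -Et e.
move=> s; have [->|sp] := pselect (s = p'); first by exists p.
have [t tp Et] := cr_surj ((cr p' q' r' s - T`_0) * (T`_1)^-1) pq rp rq.
exists t; have [htp Eht] := given_everywhere tp.
apply: (cr_inj p'q' r'p' r'q' htp sp).
by rewrite Eht TE Et mulrCA divff // mulr1 addrC subrK.
Qed.

End PolynomialMaps.

(** * Comparing two scales under a rational map *)

Section Zoom.
Context {R : realType}.
Local Notation C := (Cplx R).
Local Notation S := (rsphere R).
Local Open Scope ring_scope.
Local Open Scope classical_set_scope.

Lemma sparse_nodes (k : S -> S) (Xk : set S) (c e : S) : continuous k ->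
  (exists s t, k s <> k t) -> finite_set Xk ->
  exists2 t : nat -> S, injective t & forall i, [/\ ~ Xk (t i), t i <> e & k (t i) <> c].
Proof.
move=> kc kn fX; have fX' : finite_set (Xk `|` [set e]) by rewrite finite_setU.
have [t tinj tP] := generic_points c kc kn fX'.
by exists t => // i; have [/not_orP[? ?] ?] := tP i.
Qed.

(** Fixed points of the limit sphere serve as nodes of interpolation: their
    coordinates vary with [n], but their limits are distinct. *)
Lemma node_separation (G Gi : nat -> S -> S) (p q r : nat -> S) (P Q E : S)
    (t : nat -> S) : framed G p q r P Q E -> (forall n, cancel (Gi n) (G n)) ->
  injective t -> (forall i, t i <> P) ->
  let z i n := cr (p n) (q n) (r n) (Gi n (t i)) in
  (forall i, z i n @[n --> \oo] --> cr P Q E (t i)) /\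
  forall i j, i <> j ->
    (z i n - z j n)^-1 @[n --> \oo] --> (cr P Q E (t i) - cr P Q E (t j))^-1 /\
    \forall n \near \oo, z i n != z j n.
Proof.
move=> fr GiK tinj tP z.
have zl i : z i n @[n --> \oo] --> cr P Q E (t i).
  apply: (framed_cvg fr) (tP i); under eq_cvg do rewrite GiK; exact: cvg_cst.
split => // i j ij; have [PQ EP EQ] := frame_neq fr.
have lij : cr P Q E (t i) - cr P Q E (t j) != 0.
  by rewrite subr_eq0; apply/eqP => /(cr_inj PQ EP EQ (tP i) (tP j)) /tinj.
have zij : z i n - z j n @[n --> \oo] --> cr P Q E (t i) - cr P Q E (t j).
  exact: (cvg_sub (zl i) (zl j)).
split; first exact: (cvg_inv lij zij).
by apply: filterS (cvg_neq0 zij lij) => n; rewrite subr_eq0.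
Qed.

(** Four points of which [b] is to be sent to infinity and [x] to 0, while
    [o] and [w] are the units of a coarse and of a fine scale. *)
Definition apart (b x o w : S) : Prop :=
  [/\ b <> x, o <> b, o <> x, w <> b & w <> x].

Context (d : nat) (f : nat -> S -> S)
  (fd : forall n, rational_of_degree d (f n)).
Context (b x o w b' x' o' w' : nat -> S)
  (bxow : forall n, apart (b n) (x n) (o n) (w n))
  (bxow' : forall n, apart (b' n) (x' n) (o' n) (w' n)).
(* the coarse charts A and A', in which f tends to g *)
Context (A A' Ai : nat -> S -> S) (Ab Ax Ao Ab' Ax' Ao' : S)
  (frA : framed A b x o Ab Ax Ao) (frA' : framed A' b' x' o' Ab' Ax' Ao')
  (AiK : forall n, cancel (Ai n) (A n))
  (g : S -> S) (Xg : set S) (gc : continuous g) (gn : exists s t, g s <> g t)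
  (fXg : finite_set Xg)
  (fg : forall t, ~ Xg t -> A' n (f n (Ai n t)) @[n --> \oo] --> g t)
  (Aw : A n (w n) @[n --> \oo] --> Ax).
(* the fine charts B and B', in which f tends to h *)
Context (B B' Bi : nat -> S -> S) (Bb Bx Bw Bb' Bx' Bw' : S)
  (frB : framed B b x w Bb Bx Bw) (frB' : framed B' b' x' w' Bb' Bx' Bw')
  (BiK : forall n, cancel (Bi n) (B n))
  (h : S -> S) (Xh : set S) (hc : continuous h) (hn : exists s t, h s <> h t)
  (fXh : finite_set Xh)
  (fh : forall t, ~ Xh t -> B' n (f n (Bi n t)) @[n --> \oo] --> h t).
(* the preimages of b' stay away from the disk that is being zoomed into *)
Context (I : finType) (y : nat -> I -> S) (L : I -> S)
  (yP : forall n s, f n s = b' n -> exists a, s = y n a)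
  (Ay : forall a, A n (y n a) @[n --> \oo] --> L a)
  (Lx : forall a, L a <> Ax).

Let zeta n s := cr (b n) (x n) (o n) s.
Let zeta' n s := cr (b' n) (x' n) (o' n) s.
Let eta n s := cr (b n) (x n) (w n) s.
Let eta' n s := cr (b' n) (x' n) (w' n) s.
Let rho n := zeta n (w n).
Let rho' n := zeta' n (w' n).

Lemma rho_neq0 n : rho n != 0.
Proof. by have [bx ob ox wb wx] := bxow n; rewrite cr_eq0 //; apply/eqP. Qed.

Lemma rho'_neq0 n : rho' n != 0.
Proof. by have [bx ob ox wb wx] := bxow' n; rewrite cr_eq0 //; apply/eqP. Qed.

Lemma rho_cvg0 : rho n @[n --> \oo] --> (0 : C).
Proof.
have [AbAx AoAb AoAx] := frame_neq frA; have AxAb : Ax <> Ab by exact: nesym.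
have -> : (0 : C) = cr Ab Ax Ao Ax.
  by apply/esym/eqP; rewrite (cr_eq0 AbAx AoAb AoAx AxAb) eqxx.
exact: (framed_cvg frA Aw AxAb).
Qed.

Lemma fine_coord n s : s <> b n -> zeta n s = rho n * eta n s.
Proof.
move=> sb; have [bx ob ox wb wx] := bxow n.
rewrite /eta (cr_rescale bx ob ox wb wx sb).
by rewrite -/(zeta n s) -/(zeta n (w n)) -/(rho n) mulrC divfK // rho_neq0.
Qed.

Lemma fine_coord' n s : s <> b' n -> eta' n s = zeta' n s / rho' n.
Proof.
move=> sb; have [bx ob ox wb wx] := bxow' n.
by rewrite /eta' (cr_rescale bx ob ox wb wx sb).
Qed.

Lemma y_neq_x : \forall n \near \oo, forall a, y n a <> x n.
Proof.
apply: filter_forall => a; exact: (near_neq (@Lx a) (@Ay a) (frame_q frA)).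
Qed.

(** The roots of the denominators are the coordinates of the preimages of [b'],
    which stay away from 0; their inverses are the coordinates in the chart
    where 0 and infinity are exchanged. *)
Lemma root_bound : exists M : C, 0 <= M /\
  \forall n \near \oo, forall a, `|cr (x n) (b n) (o n) (y n a)| <= M.
Proof.
have bd a : exists M : C, 0 <= M /\
    \forall n \near \oo, `|cr (x n) (b n) (o n) (y n a)| <= M.
  by apply: cvg_bounded_seq; apply: (framed_cvg (framed_swap frA) (@Ay a)); exact: Lx.
have [M MP] := choice bd; exists (\sum_a M a); split.
  by apply: sumr_ge0 => a _; case: (MP a).
apply: filter_forall => a; have [_] := MP a; apply: filterS => n /le_trans; apply.
rewrite (bigD1 a) //= lerDl sumr_ge0 // => c _; by case: (MP c).
Qed.

Let good_form (N D : nat -> {poly C}) (M : C) n : Prop :=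
  [/\ (D n).[0] = 1, forall z, (D n).[z] = 0 -> `|z^-1| <= M &
      forall s, s <> b n ->
        zeta' n (f n s) = (N n).[zeta n s] / (D n).[zeta n s] /\
        ((D n).[zeta n s] == 0) = (f n s == b' n)].

(** The denominators can be normalised to be 1 at 0: this is the coordinate of
    [x n], which is not a preimage of [b' n] for large [n]. *)
Lemma coarse_form : exists (N D : nat -> {poly C}) (M : C),
  [/\ 0 <= M, forall n, (size (N n) <= d.+1)%N,
    forall n, (size (D n) <= d.+1)%N &
    \forall n \near \oo, good_form N D M n].
Proof.
have ND n : exists ND : {poly C} * {poly C},
    [/\ (size ND.1 <= d.+1)%N, (size ND.2 <= d.+1)%N &
    forall s, s <> b n ->
      zeta' n (f n s) = ND.1.[zeta n s] / ND.2.[zeta n s] /\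
      (ND.2.[zeta n s] == 0) = (f n s == b' n)].
  have [bx ob ox _ _] := bxow n; have [bx' ob' ox' _ _] := bxow' n.
  have [N [D H]] := rational_in_charts (fd n) bx ob ox bx' ob' ox'.
  by exists (N, D).
have {ND}[ND NDP] := choice ND; have [M [M0 yM]] := root_bound.
pose c n : C := (ND n).2.[0]^-1.
exists (fun n => c n *: (ND n).1), (fun n => c n *: (ND n).2), M; split => //.
- by move=> n; have [sN _ _] := NDP n; exact: leq_trans (size_scale_leq _ _) sN.
- by move=> n; have [_ sD _] := NDP n; exact: leq_trans (size_scale_leq _ _) sD.
near=> n; have [_ _ NDE] := NDP n; have [bx ob ox _ _] := bxow n.
have xb : x n <> b n by exact: nesym.
have yx : forall a, y n a <> x n by near: n; exact: y_neq_x.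
have yMn : forall a, `|cr (x n) (b n) (o n) (y n a)| <= M by near: n; exact: yM.
have zx : zeta n (x n) = 0 by apply/eqP; rewrite (cr_eq0 bx ob ox xb) eqxx.
have D0 : (ND n).2.[0] != 0.
  have [_] := NDE _ xb; rewrite zx => ->.
  by apply/eqP => /yP [a] /esym; exact: yx.
have c0 : c n != 0 by rewrite invr_eq0.
split.
- by rewrite hornerZ /c mulVf.
- move=> z; rewrite hornerZ => /eqP; rewrite mulf_eq0 (negPf c0) /= => Dz.
  have [s sb Es] := cr_surj z bx ob ox.
  have [_] := NDE s sb; rewrite /zeta Es Dz => /esym /eqP /yP [a sa].
  have sx : s <> x n by rewrite sa.
  have E := cr_swap sb sx ob ox; rewrite Es in E.
  have z0 : z != 0.
    by apply/eqP => z0; have := oner_neq0 C; rewrite -E z0 mul0r eqxx.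
  have -> : z^-1 = cr (x n) (b n) (o n) s by rewrite -[RHS](mulKf z0) E mulr1.
  by rewrite sa.
- move=> s sb; have [E1 E2] := NDE s sb; rewrite !hornerZ E1; split.
    by rewrite -mulf_div divff // mul1r.
  by rewrite mulf_eq0 (negPf c0).
Unshelve. all: by end_near. Qed.

Section Coarse.
Context (N D : nat -> {poly C}) (M : C) (M0 : 0 <= M)
  (sN : forall n, (size (N n) <= d.+1)%N) (sD : forall n, (size (D n) <= d.+1)%N)
  (ND : \forall n \near \oo, good_form N D M n).

(** At the coarse scale the maps converge at generic points, and their
    denominators are bounded there; interpolation does the rest. *)
Lemma numerators_bounded k : bounded_seq (fun n => (N n)`_k).
Proof.
have [t tinj tP] := sparse_nodes Ab' Ab gc gn fXg.
have tX i : ~ Xg (t i) by case: (tP i).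
have tb i : t i <> Ab by case: (tP i).
have gtb i : g (t i) <> Ab' by case: (tP i).
have [zl zsep] := node_separation frA AiK tinj tb.
apply: (interpolation bounded_seq0 bounded_seqB bounded_seqM bounded_seq_near sN
  (z := fun i n => zeta n (Ai n (t i)))).
- by move=> i; apply: cvg_bounded_seq; exact: zl.
- by move=> i j /zsep[zij nz]; split => //; apply: cvg_bounded_seq; exact: zij.
move=> i; have zbd := cvg_bounded_seq (zl i).
have val := cvg_bounded_seq (framed_cvg frA' (fg (tX i)) (gtb i)).
have Dbd : bounded_seq (fun n => (D n).[zeta n (Ai n (t i))]).
  have [Mz [Mz0 zM]] := zbd; exists ((1 + M * Mz) ^+ d).
  have MMz : 0 <= 1 + M * Mz by rewrite addr_ge0 // mulr_ge0.
  split; first exact: exprn_ge0.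
  near=> n; have [D0 Dr _] : good_form N D M n by near: n; exact: ND.
  have zn : `|zeta n (Ai n (t i))| <= Mz by near: n; exact: zM.
  have := far_roots (zeta n (Ai n (t i))) M0 (sD n) D0 Dr.
  rewrite lerBrDr => Dw; apply: le_trans (_ : _ <= (1 + M * `|zeta n (Ai n (t i))|) ^+ d) _.
    apply: le_trans Dw; rewrite -[X in `|X| <= _](subrK 1).
    by apply: le_trans (ler_normD _ _) _; rewrite normr1.
  apply: lerXn2r; rewrite ?nnegrE ?addr_ge0 ?mulr_ge0 //.
  by rewrite lerD2l ler_wpM2l.
apply: bounded_seq_near (bounded_seqM val Dbd).
have fb := near_neq (gtb i) (fg (tX i)) (frame_p frA').
have tb' : \forall n \near \oo, Ai n (t i) <> b n.
  apply: near_neq (tb i) _ (frame_p frA).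
  by under eq_cvg do rewrite AiK; exact: cvg_cst.
near=> n; have [_ _ /(_ (Ai n (t i)))[]] : good_form N D M n by near: n; exact: ND.
  by near: n; exact: tb'.
rewrite -/(zeta' n (f n (Ai n (t i)))) => -> Dz; rewrite divfK // Dz.
by apply/eqP; near: n; exact: fb.
Unshelve. all: by end_near. Qed.

(** The fine scale sees an infinitesimal part of the coarse chart. *)
Lemma fine_denominators (u : nat -> C) (l : C) : u n @[n --> \oo] --> l ->
  (D n).[rho n * u n] @[n --> \oo] --> (1 : C).
Proof.
move=> ul; apply: (@cvg_squeeze _ _ (fun n => (1 + M * `|rho n * u n|) ^+ d - 1)).
  near=> n; have [D0 Dr _] : good_form N D M n by near: n; exact: ND.
  exact: far_roots.
have ru : rho n * u n @[n --> \oo] --> (0 : C).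
  by rewrite -(mul0r l); exact: (cvg_mul rho_cvg0 ul).
have nru : `|rho n * u n| @[n --> \oo] --> (0 : C).
  by rewrite -(normr0 C); exact: (@cvg_norm C C _ _ _ _ _ ru).
pose T : {poly C} := (1 + M *: 'X) ^+ d - 1.
have TE v : T.[v] = (1 + M * v) ^+ d - 1.
  by rewrite hornerD horner_exp hornerN hornerD hornerZ hornerX !hornerC.
have Tl : T.[`|rho n * u n|] @[n --> \oo] --> T.[0] by exact: (cvg_horner T nru).
have T0 : T.[0] = 0 by rewrite TE mulr0 addr0 expr1n subrr.
rewrite T0 in Tl.
by apply: cvg_near Tl; near=> n; rewrite TE.
Unshelve. all: by end_near. Qed.

(** The numerators read at the fine scale have the coefficients
    [N_k * rho ^ k / rho']. As the maps converge there and the denominators tend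
    to 1, interpolation applies once more. *)
Lemma fine_limit : exists c : nat -> C,
  (forall k, (k < d.+1)%N -> (N n)`_k * rho n ^+ k / rho' n @[n --> \oo] --> c k) /\
  forall t, ~ Xh t -> t <> Bb ->
    given_by h Bb Bx Bw Bb' Bx' Bw' (\poly_(k < d.+1) c k) t.
Proof.
pose Q n := \poly_(k < d.+1) ((N n)`_k * rho n ^+ k / rho' n).
have QE n (v : C) : (Q n).[v] = (N n).[rho n * v] / rho' n.
  rewrite horner_poly (horner_coef_wide _ (sN n)) mulr_suml.
  by apply: eq_bigr => k _; rewrite [in RHS]exprMn mulrA [LHS]mulrAC.
have fineE : \forall n \near \oo, forall s, s <> b n -> f n s <> b' n ->
    eta' n (f n s) * (D n).[rho n * eta n s] = (Q n).[eta n s].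
  apply: filterS ND => n [_ _ NDn] s sb fsb; have [E1 E2] := NDn s sb.
  rewrite QE -fine_coord // fine_coord' // E1 mulrAC divfK // E2.
  exact/eqP.
have value t (vt : ~ Xh t) (tb : t <> Bb) (hb : h t <> Bb') :
    (Q n).[eta n (Bi n t)] @[n --> \oo] --> cr Bb' Bx' Bw' (h t).
  have el : eta n (Bi n t) @[n --> \oo] --> cr Bb Bx Bw t.
    by apply: (framed_cvg frB) (tb); under eq_cvg do rewrite BiK; exact: cvg_cst.
  have el' : eta' n (f n (Bi n t)) @[n --> \oo] --> cr Bb' Bx' Bw' (h t).
    exact: (framed_cvg frB' (fh vt) hb).
  have fb := near_neq hb (fh vt) (frame_p frB').
  have tbn : \forall n \near \oo, Bi n t <> b n.
    apply: near_neq (tb) _ (frame_p frB).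
    by under eq_cvg do rewrite BiK; exact: cvg_cst.
  rewrite -[X in _ --> X]mulr1; apply: cvg_near (cvg_mul el' (fine_denominators el)).
  near=> n; have fE : forall s, s <> b n -> f n s <> b' n ->
    eta' n (f n s) * (D n).[rho n * eta n s] = (Q n).[eta n s] by near: n; exact: fineE.
  by apply: fE; near: n; [exact: tbn|exact: fb].
have [c Qc] : exists c : nat -> C, forall k, (Q n)`_k @[n --> \oo] --> c k.
  suff H k : exists l : C, (Q n)`_k @[n --> \oo] --> l by have [c] := choice H; exists c.
  have [t tinj tP] := sparse_nodes Bb' Bb hc hn fXh.
  have tX i : ~ Xh (t i) by case: (tP i).
  have tb i : t i <> Bb by case: (tP i).
  have htb i : h (t i) <> Bb' by case: (tP i).
  have [zl zsep] := node_separation frB BiK tinj tb.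
  apply: (@interpolation _ (fun u => exists l : C, u n @[n --> \oo] --> l)
    _ _ _ _ d.+1 Q (fun i n => eta n (Bi n (t i)))).
  - by exists 0; exact: cvg_cst.
  - by move=> u v [l ul] [m vm]; exists (l - m); exact: (cvg_sub ul vm).
  - by move=> u v [l ul] [m vm]; exists (l * m); exact: (cvg_mul ul vm).
  - by move=> u v uv [l ul]; exists l; exact: cvg_near uv ul.
  - by move=> n; exact: size_poly.
  - by move=> i; exists (cr Bb Bx Bw (t i)); exact: zl.
  - by move=> i j /zsep[zij nz]; split => //; eexists; exact: zij.
  - by move=> i; eexists; exact: (value _ (tX i) (tb i) (htb i)).
pose q := \poly_(k < d.+1) c k.
have Qq (u : nat -> C) (l : C) : u n @[n --> \oo] --> l -> (Q n).[u n] @[n --> \oo] --> q.[l].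
  move=> ul; rewrite horner_poly.
  apply: (@cvg_near _ _ _ _ (fun n => \sum_(k < d.+1) (Q n)`_k * u n ^+ k)).
    by near=> n; rewrite (horner_coef_wide _ (size_poly _ _)).
  elim: (index_enum _) => [|k ks IH].
    by rewrite big_nil; under eq_cvg do rewrite big_nil; exact: cvg_cst.
  rewrite big_cons; under eq_cvg do rewrite big_cons.
  exact: (cvg_add (cvg_mul (Qc k) (cvg_exp k ul)) IH).
exists c; split.
  move=> k kd; apply: cvg_near (Qc k).
  by near=> n; rewrite coef_poly kd.
have hq0 t : ~ Xh t -> t <> Bb -> h t <> Bb' /\ cr Bb' Bx' Bw' (h t) = q.[cr Bb Bx Bw t].
  move=> vt tb.
  have el : eta n (Bi n t) @[n --> \oo] --> cr Bb Bx Bw t.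
    by apply: (framed_cvg frB) (tb); under eq_cvg do rewrite BiK; exact: cvg_cst.
  have tbn : \forall n \near \oo, Bi n t <> b n.
    apply: near_neq (tb) _ (frame_p frB).
    by under eq_cvg do rewrite BiK; exact: cvg_cst.
  have Dn0 := cvg_neq0 (fine_denominators el) (oner_neq0 C).
  have fb : \forall n \near \oo, f n (Bi n t) <> b' n.
    near=> n; have [_ _ /(_ (Bi n t))[]] : good_form N D M n by near: n; exact: ND.
      by near: n; exact: tbn.
    have tbn' : Bi n t <> b n by near: n; exact: tbn.
    move=> _; rewrite fine_coord // => E; apply/eqP; rewrite -E.
    by near: n; exact: Dn0.
  apply: (framed_lim frB' (fh vt) fb).
  rewrite -[X in _ --> X]divr1.
  apply: cvg_near (cvg_mul (Qq _ _ el)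
    (cvg_inv (oner_neq0 C) (fine_denominators el))).
  near=> n; have fE : forall s, s <> b n -> f n s <> b' n ->
    eta' n (f n s) * (D n).[rho n * eta n s] = (Q n).[eta n s] by near: n; exact: fineE.
  rewrite -fE; [|by near: n; exact: tbn|by near: n; exact: fb].
  by rewrite mulfK //; near: n; exact: Dn0.
Unshelve. all: by end_near. Qed.

End Coarse.

(** The numerators have bounded coefficients at the coarse scale, while at the
    fine scale, where the coefficient of degree [k] is multiplied by
    [rho ^ k / rho'], they converge to those of the polynomial expressing [h].
    Each nonzero coefficient of the latter thus bounds [rho'] by a power of
    [rho], and a nonzero coefficient of degree at least 2 is missing only if
    [h] is affine. *)
Lemma zoom_step :
  (exists K : C, 0 <= K /\ \forall n \near \oo, `|rho' n| <= K * `|rho n|) /\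
  (bijection h \/
   exists K : C, 0 <= K /\ \forall n \near \oo, `|rho' n| <= K * `|rho n| ^+ 2).
Proof.
have [N [D [M [M0 sN sD ND]]]] := coarse_form.
have [BbBx BwBb BwBx] := frame_neq frB.
have [Bb'Bx' Bw'Bb' Bw'Bx'] := frame_neq frB'.
have [c [Qc hT]] := fine_limit M0 sN sD ND.
set T := \poly_(k < d.+1) c k in hT.
have T1 := given_nonconstant hc hn BbBx BwBb BwBx Bb'Bx' Bw'Bb' Bw'Bx' fXh hT.
have compare k : T`_k != 0 ->
    exists K : C, 0 <= K /\ \forall n \near \oo, `|rho' n| <= K * `|rho n| ^+ k.
  rewrite coef_poly; case: ltnP => [kd ck|_]; last by rewrite eqxx.
  have [K1 [K10 NK]] := numerators_bounded M0 sN sD ND k.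
  have QV : ((N n)`_k * rho n ^+ k / rho' n)^-1 @[n --> \oo] --> (c k)^-1.
    exact: (cvg_inv ck (Qc k kd)).
  have [K2 [K20 QK]] := cvg_bounded_seq QV.
  exists (K1 * K2); split; first exact: mulr_ge0.
  near=> n; have Q0 : (N n)`_k * rho n ^+ k / rho' n != 0.
    by near: n; exact: cvg_neq0 (Qc k kd) ck.
  have QKn : `|((N n)`_k * rho n ^+ k / rho' n)^-1| <= K2 by near: n; exact: QK.
  have -> : rho' n = (N n)`_k * ((N n)`_k * rho n ^+ k / rho' n)^-1 * rho n ^+ k.
    apply: (mulIf Q0); rewrite [RHS]mulrAC divfK // mulrC divfK //.
    exact: rho'_neq0.
  rewrite normrM normrX normrM; apply: ler_wpM2r; first exact: exprn_ge0.
  by apply: ler_pM => //; near: n; exact: NK.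
have rho1 : \forall n \near \oo, `|rho n| <= 1.
  have /(@cvgrPdist_lt C C) /(_ 1 ltr01) := rho_cvg0; apply: filterS => n.
  by rewrite sub0r normrN => /ltW.
have weaken j m : (m <= j)%N -> (exists K : C, 0 <= K /\
      \forall n \near \oo, `|rho' n| <= K * `|rho n| ^+ j) ->
    exists K : C, 0 <= K /\ \forall n \near \oo, `|rho' n| <= K * `|rho n| ^+ m.
  move=> mj [K [K0 KP]]; exists K; split => //.
  apply: filterS2 KP rho1 => n /le_trans le r1; apply: le.
  by apply: ler_wpM2l => //; apply: ler_wiXn2l.
have lead : T`_(size T).-1 != 0.
  by rewrite -/(lead_coef T) lead_coef_eq0 -size_poly_gt0 (ltn_trans _ T1).
have degT : (1 <= (size T).-1)%N by rewrite -subn1 leq_subRL // (ltn_trans _ T1).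
split.
  have [K [K0 KP]] := weaken _ _ degT (compare _ lead).
  by exists K; split => //; apply: filterS KP => n; rewrite expr1.
have [sT|sT] := ltnP 2 (size T).
  right; apply: weaken (compare _ lead).
  by rewrite -subn1 leq_subRL // (ltn_trans _ sT).
left; apply: (given_affine_bijective hc BbBx BwBb BwBx Bb'Bx' Bw'Bb' Bw'Bx' fXh hT).
by apply/eqP; rewrite eqn_leq sT T1.
Unshelve. all: by end_near. Qed.

End Zoom.

(** * Directions, marked leaves and their limits *)

Section Directions.
Context {R : realType} {V : finType} {Sph : V -> projSphere R} {X Y Z : {set V}}.
Context (TX : sphereTree Sph X) (TY : sphereTree Sph Y) (TZ : sphereTree Sph Z).
Context (XY : X \subset Y) (XZ : X \subset Z).
Context (intXYZ : forall v, v \in internal TX ->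
  v \in internal TY /\ v \in internal TZ)
  (attXYZ : forall v x, v \in internal TX -> x \in X ->
  attpt TX v x = attpt TY v x /\ attpt TX v x = attpt TZ v x).

Lemma attpt_behind_leaf (L : {set V}) (T : sphereTree Sph L) u u' x :
  u \in internal T -> u' \in internal T -> u != u' -> x \in L ->
  attpt T u' x <> attpt T u' u -> attpt T u x = attpt T u u'.
Proof.
move=> uT u'T uu' xL; apply: attpt_behind => //.
- exact: internal_vert.
- exact: internal_vert.
- exact: leaf_vert.
- exact: leaf_internal_neq xL uT.
- exact: leaf_internal_neq xL u'T.
Qed.

(** The direction from [u] to [u'] is seen on a common leaf behind [u']. *)
Lemma direction_agrees u u' : u \in internal TX -> u' \in internal TX -> u != u' ->
  attpt TZ u u' = attpt TY u u'.
Proof.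
move=> uX u'X uu'; have [uY uZ] := intXYZ uX; have [u'Y u'Z] := intXYZ u'X.
have [x [xX xs xt]] := leaf_avoiding (attpt TY u' u) (attpt TZ u' u) u'X.
have xY := fintype.subsetP XY _ xX; have xZ := fintype.subsetP XZ _ xX.
have [EY EZ] := attXYZ u'X xX.
have EuY : attpt TY u x = attpt TY u u'.
  by apply: attpt_behind_leaf => //; rewrite -EY.
have EuZ : attpt TZ u x = attpt TZ u u'.
  by apply: attpt_behind_leaf => //; rewrite -EZ.
by rewrite -EuY -EuZ; have [<- <-] := attXYZ uX xX.
Qed.

(** A disk around the direction of [u'] at [u] is to be zoomed into: [b] marks
    infinity and [x] the origin of both scales, while [o] is the unit of the
    scale of [u] and [w] that of the scale of [u']. *)
Definition marks (u u' : V) (m : V * V * V * V) : Prop :=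
  let: (b, x, o, w) := m in
  [/\ [/\ b \in X, x \in X, o \in X & w \in X],
      [/\ attpt TX u b <> attpt TY u u', attpt TX u o <> attpt TY u u' &
          attpt TX u o <> attpt TX u b],
      attpt TX u x = attpt TY u u' /\ attpt TX u w = attpt TY u u',
      attpt TX u' b = attpt TY u' u &
      [/\ attpt TX u' x <> attpt TY u' u, attpt TX u' w <> attpt TY u' u &
          attpt TX u' w <> attpt TX u' x]].

Lemma marks_exist u u' : u \in internal TX -> u' \in internal TX -> u != u' ->
  exists m, marks u u' m.
Proof.
move=> uX u'X uu'; have [uY _] := intXYZ uX; have [u'Y _] := intXYZ u'X.
pose t := attpt TY u u'; pose s := attpt TY u' u.
have [b [bX bt _]] := leaf_avoiding t t uX.
have [c [cX ct cb]] := leaf_avoiding t (attpt TX u b) uX.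
have [x [xX xs _]] := leaf_avoiding s s u'X.
have [w [wX ws wx]] := leaf_avoiding s (attpt TX u' x) u'X.
have behind a : a \in X -> attpt TX u' a <> s -> attpt TX u a = t.
  move=> aX; have [-> _] := attXYZ u'X aX; have [-> _] := attXYZ uX aX.
  by apply: attpt_behind_leaf => //; apply: fintype.subsetP XY _ aX.
exists (b, x, c, w); split=> //.
- by split; apply: behind.
- have [-> _] := attXYZ u'X bX; apply: attpt_behind_leaf => //; rewrite 1?eq_sym //.
    exact: fintype.subsetP XY _ bX.
  by have [<- _] := attXYZ uX bX.
Qed.

End Directions.

Section Charts.
Context {R : realType} {V : finType} {Sph : V -> projSphere R}.
Local Notation S := (rsphere R).
Local Open Scope ring_scope.
Local Open Scope classical_set_scope.

Definition chart (P : projSphere R) (phi : sphereIso P) : S -> S :=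
  fun s => toS (phi s).

Definition unchart (P : projSphere R) (phi : sphereIso P) : S -> S :=
  fun s => iso_inv phi (ofS P s).

Lemma unchartK (P : projSphere R) (phi : sphereIso P) :
  cancel (unchart phi) (chart phi).
Proof. by move=> s; rewrite /chart /unchart iso_invK ofSK. Qed.

Lemma chart_moebius (P : projSphere R) (phi : sphereIso P) :
  rational_of_degree 1 (chart phi) /\ injective (chart phi).
Proof.
split; first exact: iso_moebius.
by move=> s t /(can_inj (@toSK _ P)) /(can_inj (iso_funK phi)).
Qed.

Lemma toS_inj (P : projSphere R) : injective (@toS R P).
Proof. exact: can_inj (@toSK _ P). Qed.

Lemma cvg_toS (P : projSphere R) (u : nat -> P) (t : P) :
  u n @[n --> \oo] --> t -> toS (u n) @[n --> \oo] --> toS t.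
Proof.
move=> ut; have c := @initial_continuous _ _ (@toS R P) t.
exact: (cvg_comp u (@toS R P) ut c).
Qed.

Lemma locally_uniform_pointwise (T U : uniformType) (A : set T)
    (gs : nat -> T -> U) (g : T -> U) : cvg_locally_uniformly A gs g ->
  forall t, A t -> gs n t @[n --> \oo] --> g t.
Proof.
move=> lu t At; have [N Nt gsg] := lu t At.
have tN : [set t] `<=` N by move=> _ ->; exact: nbhs_singleton.
have : {uniform [set t], gs n @[n --> \oo] --> g}.
  exact: (uniform_subset_cvg _ tN gsg).
by rewrite uniform_set1.
Qed.

Lemma attset_finite (X : {set V}) (T : sphereTree Sph X) v : finite_set (attset T v).
Proof.
apply: (@sub_finite_set _ _ ((fun e => att T v e) @` [set` star T v])).
  by move=> t /= /existsP[e /andP[ev /eqP <-]]; exists e.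
exact: finite_image.
Qed.

End Charts.

(** * The two periodic scales *)

Section Dynamics.
Context {R : realType} {V : finType} {Sph : V -> projSphere R}
  {d : nat} {X Y Z : {set V}}.
Local Notation C := (Cplx R).
Local Notation S := (rsphere R).
Local Open Scope ring_scope.
Local Open Scope classical_set_scope.
Context (hd : (2 <= d)%N) (XY : X \subset Y) (XZ : X \subset Z)
  (pF : V -> V) (pdeg : V -> nat) (hF : is_portrait d Y Z pF pdeg)
  (TX : sphereTree Sph X) (TY : sphereTree Sph Y) (TZ : sphereTree Sph Z)
  (F : V -> V) (f : forall v, Sph v -> Sph (F v))
  (dyn : DynFX pF pdeg TX TY TZ f)
  (fs : nat -> S -> S) (ys zs : nat -> V -> S)
  (rat : forall n, RatFX d X Y Z pF pdeg (fs n) (ys n) (zs n))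
  (phiY phiZ : nat -> forall v, sphereIso (Sph v))
  (cvY : forall v a, v \in internal TY -> a \in Y ->
     phiY n v (ys n a) @[n --> \oo] --> attpt TY v a)
  (cvZ : forall v b, v \in internal TZ -> b \in Z ->
     phiZ n v (zs n b) @[n --> \oo] --> attpt TZ v b)
  (cvf : forall v, v \in internal TY ->
     cvg_locally_uniformly (~` attset TY v)
       (fun n t => phiZ n (F v) (fs n (iso_inv (phiY n v) t))) (@f v)).

Let cover : is_cover TY TZ f. Proof. by case: dyn. Qed.
Let portrait : has_portrait pF pdeg TY f. Proof. by case: dyn. Qed.

Lemma intXYZ v : v \in internal TX -> v \in internal TY /\ v \in internal TZ.
Proof. by case: dyn => _ _ + _; apply. Qed.

Lemma attXYZ v x : v \in internal TX -> x \in X ->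
  attpt TX v x = attpt TY v x /\ attpt TX v x = attpt TZ v x.
Proof. by case: dyn => _ _ _; apply. Qed.

Lemma ys_zs n a : a \in X -> ys n a = zs n a.
Proof. by case: (rat n) => _ [_ _ _ _]; apply. Qed.

Lemma zs_neq n a b : a \in X -> b \in X -> a <> b -> zs n a <> zs n b.
Proof.
move=> aX bX ab E; apply: ab; case: (rat n) => _ [_ zinj _ _ _].
by apply: zinj => //; apply: fintype.subsetP XZ _ _.
Qed.

(** The charts of the source and of the target need not be related, but the
    marked leaves have the same limits in both, which is all that matters for
    cross-ratios. *)
Lemma cvY_leaf v a : v \in internal TX -> a \in X ->
  chart (phiY n v) (zs n a) @[n --> \oo] --> toS (attpt TX v a).
Proof.
move=> vX aX; have [vY _] := intXYZ vX; have [-> _] := attXYZ vX aX.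
have aY := fintype.subsetP XY _ aX.
have := cvg_toS (cvY vY aY).
by under eq_cvg do rewrite ys_zs //.
Qed.

Lemma cvZ_leaf v a : v \in internal TX -> a \in X ->
  chart (phiZ n v) (zs n a) @[n --> \oo] --> toS (attpt TX v a).
Proof.
move=> vX aX; have [_ vZ] := intXYZ vX; have [_ ->] := attXYZ vX aX.
exact: cvg_toS (cvZ vZ (fintype.subsetP XZ _ aX)).
Qed.

Lemma leaf_neq v a b : attpt TX v a <> attpt TX v b -> a <> b.
Proof. by move=> ne ab; apply: ne; rewrite ab. Qed.

(** The marks are chosen as a function of the pair of vertices, so that what is
    measured with them is periodic along a cycle of pairs. *)
Lemma marks_choice : exists mk : V * V -> V * V * V * V,
  forall u u', u \in internal TX -> u' \in internal TX -> u != u' ->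
  marks TX TY u u' (mk (u, u')).
Proof.
have H (uu : V * V) : exists m, uu.1 \in internal TX -> uu.2 \in internal TX ->
    uu.1 != uu.2 -> marks TX TY uu.1 uu.2 m.
  have [/and3P[u1 u2 u12]|no] :=
    boolP [&& uu.1 \in internal TX, uu.2 \in internal TX & uu.1 != uu.2].
    by have [m mP] := marks_exist XY intXYZ attXYZ u1 u2 u12; exists m.
  exists (uu.1, uu.1, uu.1, uu.1) => u1 u2 u12; move: no; rewrite u1 u2 u12.
  by [].
have [mk mkP] := choice H; exists mk => u u'; exact: (mkP (u, u')).
Qed.

(** The size of the scale of [u'] in the coordinate of [u]. *)
Definition ratio (m : V * V * V * V) n : C :=
  let: (b, x, c, w) := m in cr (zs n b) (zs n x) (zs n c) (zs n w).

Lemma marks_apart u u' b x c w n : marks TX TY u u' (b, x, c, w) ->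
  apart (zs n b) (zs n x) (zs n c) (zs n w).
Proof.
case=> [[bX xX cX wX] [bt ct cb] [xt wt] bs [xs ws wx]].
split; apply: zs_neq => //.
- by apply: (@leaf_neq u); rewrite xt.
- exact: (@leaf_neq u).
- by apply: (@leaf_neq u); rewrite xt.
- by apply: (@leaf_neq u); rewrite wt => /esym.
- exact: (@leaf_neq u').
Qed.

Lemma ratio_neq0 u u' m n : marks TX TY u u' m -> ratio m n != 0.
Proof.
case: m => [[[b x] c] w] mk.
exact: (@rho_neq0 R (zs^~ b) (zs^~ x) (zs^~ c) (zs^~ w) (fun k => marks_apart k mk) n).
Qed.

Lemma coarse_framed (phi : nat -> forall v, sphereIso (Sph v)) u u' b x c w :
  (forall a, a \in X ->
    chart (phi n u) (zs n a) @[n --> \oo] --> toS (attpt TX u a)) ->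
  marks TX TY u u' (b, x, c, w) ->
  framed (fun n => chart (phi n u)) (zs^~ b) (zs^~ x) (zs^~ c)
    (toS (attpt TX u b)) (toS (attpt TY u u')) (toS (attpt TX u c)) /\
  chart (phi n u) (zs n w) @[n --> \oo] --> toS (attpt TY u u').
Proof.
move=> cv [[bX xX cX wX] [bt ct cb] [xt wt] _ _].
have cx := cv _ xX; rewrite xt in cx; have cw := cv _ wX; rewrite wt in cw.
split; last exact: cw.
split; [by move=> n; exact: chart_moebius|exact: cv|exact: cx|exact: cv|].
by split=> /toS_inj.
Qed.

Lemma fine_framed (phi : nat -> forall v, sphereIso (Sph v)) u u' b x c w :
  (forall a, a \in X ->
    chart (phi n u') (zs n a) @[n --> \oo] --> toS (attpt TX u' a)) ->
  marks TX TY u u' (b, x, c, w) ->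
  framed (fun n => chart (phi n u')) (zs^~ b) (zs^~ x) (zs^~ w)
    (toS (attpt TY u' u)) (toS (attpt TX u' x)) (toS (attpt TX u' w)).
Proof.
move=> cv [[bX xX cX wX] _ _ bs [xs ws wx]].
have cb := cv _ bX; rewrite bs in cb.
split; [by move=> n; exact: chart_moebius|exact: cb|exact: cv|exact: cv|].
by split=> /toS_inj // /esym.
Qed.

Lemma ratio_cvg0 u u' m : u \in internal TX ->
  marks TX TY u u' m -> ratio m n @[n --> \oo] --> (0 : C).
Proof.
case: m => [[[b x] c] w] uX mk.
have [fr cw] := coarse_framed (phi := phiY) (fun a => @cvY_leaf u a uX) mk.
exact: (rho_cvg0 fr cw).
Qed.

Lemma limit_map v : v \in internal TY ->
  [/\ continuous (in_coord (@f v)),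
      exists s t, in_coord (@f v) s <> in_coord (@f v) t &
      exists2 E : set S, finite_set E & forall t, ~ E t ->
        chart (phiZ n (F v)) (fs n (unchart (phiY n v) t)) @[n --> \oo] -->
        in_coord (@f v) t].
Proof.
move=> vY; have [[fc _] [s [t st]]] := cover_ramified cover vY.
split=> //.
  exists (toS s), (toS t); rewrite /in_coord !toSK => /toS_inj.
  exact: st.
exists [set toS t | t in attset TY v].
  by apply: finite_image; exact: attset_finite.
move=> r rE; apply: cvg_toS; apply: (locally_uniform_pointwise (cvf vY)).
by move=> rA; apply: rE; exists (ofS (Sph v) r) => //; rewrite ofSK.
Qed.

(** The preimages of a marked point off the branch at [f t] are off the branch
    at [t]: this is where the hypothesis on branches enters, through the
    leaves. *)
Lemma leaf_off_branch u (t : Sph u) a b : u \in internal TY -> F u \in internal TZ ->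
  branch_maps_inside TY TZ f t -> a \in Y -> pF a = b ->
  attpt TZ (F u) b <> f t -> attpt TY u a <> t.
Proof.
move=> uY FuZ inside aY ab bt ta; apply: bt.
have aB : [set a]%SET \in branch TY t.
  apply/branch_vertP; first exact: internal_vert.
  split => //; [exact: leaf_vert|exact: leaf_internal_neq aY uY].
have := inside _ aB; rewrite imset_set1.
move=> /(branch_vertP _ _ (internal_vert FuZ)) [_ _].
by have [Fa _] := portrait; rewrite (Fa _ aY) ab.
Qed.

(** By the portrait, the fibre of the marked point [b'] consists of marked
    points, and these are off the branch at [t]; so the zoom lemma applies. *)
Lemma scale_step u u' m m' :
  u \in internal TX -> u' \in internal TX ->
  F u \in internal TX -> F u' \in internal TX ->
  marks TX TY u u' m -> marks TX TY (F u) (F u') m' ->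
  f (attpt TY u u') = attpt TY (F u) (F u') ->
  branch_maps_inside TY TZ f (attpt TY u u') ->
  (exists K : C, 0 <= K /\ \forall n \near \oo, `|ratio m' n| <= K * `|ratio m n|) /\
  (bijection (in_coord (@f u')) \/
   exists K : C, 0 <= K /\ \forall n \near \oo, `|ratio m' n| <= K * `|ratio m n| ^+ 2).
Proof.
case: m m' => [[[b x] c] w] [[[b' x'] c'] w'] uX u'X FuX Fu'X mk mk' ft inside.
have [uY _] := intXYZ uX; have [u'Y _] := intXYZ u'X; have [_ FuZ] := intXYZ FuX.
have [frA cw] := coarse_framed (phi := phiY) (fun a => @cvY_leaf u a uX) mk.
have [frA' _] := coarse_framed (phi := phiZ) (fun a => @cvZ_leaf (F u) a FuX) mk'.
have frB := fine_framed (phi := phiY) (fun a => @cvY_leaf u' a u'X) mk.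
have frB' := fine_framed (phi := phiZ) (fun a => @cvZ_leaf (F u') a Fu'X) mk'.
have [gc gn [Eg fEg cg]] := limit_map uY.
have [hc hn [Eh fEh ch]] := limit_map u'Y.
have b'X : b' \in X by case: mk' => -[].
have b't : attpt TZ (F u) b' <> f (attpt TY u u').
  rewrite ft; have [_ <-] := attXYZ FuX b'X.
  by case: mk' => _ [].
pose J := {a : V | (a \in Y) && (pF a == b')}.
have d0 : (0 < d)%N by apply: leq_trans hd.
have yP n s : fs n s = zs n b' -> exists a : J, s = ys n (val a).
  move=> fsb; have [fd [yinj zinj fy ldeg _]] := rat n.
  have [_ _ _ psum] := hF.
  have b'Z := fintype.subsetP XZ _ b'X.
  have H : (\sum_(a in [set a in Y | pF a == b']%SET) pdeg a = d)%N.
    by rewrite -[RHS](psum b' b'Z); apply: eq_bigl => a; rewrite inE.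
  have [a1 a2|a|a|a] := @fibre_exhausted R d (fs n) (zs n b') V
      [set a in Y | pF a == b']%SET (ys n) pdeg d0 fd _ _ _ H s fsb.
  - by rewrite !inE => /andP[a1Y _] /andP[a2Y _]; exact: yinj.
  - by rewrite inE => /andP[aY /eqP <-]; exact: fy.
  - by rewrite inE => /andP[aY _]; exact: ldeg.
  - by rewrite inE => aP ->; exists (Sub a aP).
have JY (a : J) : val a \in Y by case/andP: (valP a).
apply: (zoom_step (fun n => proj1 (rat n)) (fun n => marks_apart n mk)
  (fun n => marks_apart n mk') frA frA'
  (fun n => unchartK (phiY n u)) gc gn fEg cg cw frB frB'
  (fun n => unchartK (phiY n u')) hc hn fEh ch yP
  (L := fun a : J => toS (attpt TY u (val a)))).
- by move=> a; apply: cvg_toS; apply: cvY.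
- move=> a /toS_inj; apply: (leaf_off_branch uY FuZ inside (JY a) _ b't).
  by apply/eqP; case/andP: (valP a).
Qed.
End Dynamics.

(** * Degrees and cycles *)

Section Degrees.
Context {R : realType}.
Local Open Scope ring_scope.
Local Open Scope classical_set_scope.
Implicit Types P Q : projSphere R.

Lemma in_coord_bijection P Q (g : P -> Q) : bijection (in_coord g) -> bijection g.
Proof.
case=> ginj gsurj; split=> [a b gab|s].
  by apply: (@toS_inj R P); apply: ginj; rewrite /in_coord !toSK gab.
have [t Et] := gsurj (toS s); exists (ofS P t).
exact: (@toS_inj R Q).
Qed.

Lemma bijection_fibre (T U : Type) (g : T -> U) b : bijection g ->
  (g @^-1` [set b] #= `I_1)%card.
Proof.
case=> ginj gsurj; have [t <-] := gsurj b.
have -> : g @^-1` [set g t] = [set t]; last exact: card_set1.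
by apply/seteqP; split => [s /ginj|_ ->].
Qed.

Lemma bijection_degree P Q (g : P -> Q) : bijection g -> cover_degree g 1.
Proof. by move=> gb; exists set0 => // b _; exact: bijection_fibre. Qed.

Lemma bijection_degree_unique P Q (g : P -> Q) m : bijection g ->
  cover_degree g m -> m = 1%N.
Proof.
move=> gb [E fE card]; have [u uinj _] := approach (None : rsphere R).
have fE' : finite_set [set toS t | t in E] by exact: finite_image.
have [N _ NE] := near_notin uinj fE'.
have h1 : (g @^-1` [set ofS Q (u N)] #= `I_m)%card.
  apply: card => EN; apply: (NE N) => //=.
  by exists (ofS Q (u N)); rewrite ?ofSK.
have h2 := bijection_fibre (ofS Q (u N)) gb; rewrite card_eq_sym in h2.
by have /card_eq_II := card_eq_trans h2 h1.
Qed.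
End Degrees.

(** Going once around the cycle gives [rho j <= L * K * rho j ^ 2], that is
    [1 <= L * K * rho j], whereas [rho j] tends to 0. *)
Lemma cyclic_scales (R : realType) (rho : nat -> nat -> Cplx R) (P : nat) :
  (0 < P)%N -> (forall j, rho (j + P)%N = rho j) ->
  (forall j n, rho j n != 0)%R ->
  (forall j, rho j n @[n --> \oo] --> (0 : Cplx R)%R)%classic ->
  (forall j, exists K : Cplx R, (0 <= K)%R /\
     \forall n \near \oo%classic, (`|rho j.+1 n| <= K * `|rho j n|)%R) ->
  forall j, ~ exists K : Cplx R, (0 <= K)%R /\
     \forall n \near \oo%classic, (`|rho j.+1 n| <= K * `|rho j n| ^+ 2)%R.
Proof.
move=> P0 per nz lim0 step j [K [K0 KP]].
have chain i : exists L : Cplx R, (0 <= L)%R /\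
    \forall n \near \oo%classic, (`|rho (j.+1 + i)%N n| <= L * `|rho j.+1 n|)%R.
  elim: i => [|i [L [L0 LP]]].
    by exists 1%R; split => //; apply: nearW => n; rewrite addn0 mul1r.
  have [M [M0 MP]] := step (j.+1 + i)%N; exists (M * L)%R; split; first exact: mulr_ge0.
  near=> n; rewrite addnS; apply: (@le_trans _ _ (M * `|rho (j.+1 + i)%N n|)%R).
    by near: n; exact: MP.
  by rewrite -mulrA; apply: ler_wpM2l => //; near: n; exact: LP.
have [L [L0 LP]] := chain P.-1.
have E : rho (j.+1 + P.-1)%N = rho j by rewrite addSnnS prednK.
rewrite E in LP.
have one n : (`|rho j n| <= L * `|rho j.+1 n|)%R -> (`|rho j.+1 n| <= K * `|rho j n| ^+ 2)%R ->
    (1 <= L * K * `|rho j n|)%R.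
  move=> h1 h2; have r0 : (0 < `|rho j n|)%R by rewrite normr_gt0.
  rewrite -(ler_pM2r r0) mul1r; apply: le_trans h1 _.
  by rewrite -!mulrA -expr2; apply: ler_wpM2l.
have small : \forall n \near \oo%classic, (L * K * `|rho j n| < 1)%R.
  have e0 : (0 < (1 + L * K)^-1 :> Cplx R)%R by rewrite invr_gt0 ltr_wpDr // mulr_ge0.
  have LK0 : (0 <= L * K)%R by exact: mulr_ge0.
  have p0 : (0 < 1 + L * K)%R by rewrite ltr_wpDr.
  have /(@cvgrPdist_lt (Cplx R) (Cplx R)) /(_ _ e0) := lim0 j; apply: filterS => n.
  rewrite sub0r normrN => h; apply: (@le_lt_trans _ _ ((1 + L * K) * `|rho j n|)%R).
    by apply: ler_wpM2r => //; rewrite lerDr.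
  by rewrite -ltr_pdivlMl // mulr1.
have : \forall n \near \oo%classic, False.
  near=> n; have h1 : (`|rho j n| <= L * `|rho j.+1 n|)%R by near: n; exact: LP.
  have h2 : (`|rho j.+1 n| <= K * `|rho j n| ^+ 2)%R by near: n; exact: KP.
  have h3 : (L * K * `|rho j n| < 1)%R by near: n; exact: small.
  by have := le_lt_trans (one n h1 h2) h3; rewrite ltxx.
by case=> n _ /(_ n) /=; apply.
Unshelve. all: by end_near. Qed.

Theorem lemma3p1 (R : realType) (V : finType) (Sph : V -> projSphere R)
  (d : nat) (X Y Z : {set V})
  (hd : (2 <= d)%N)
  (hX : (3 <= #|X|)%N) (hY : (3 <= #|Y|)%N) (hZ : (3 <= #|Z|)%N)
  (hXYZ : X \subset Y :&: Z)
  (pF : V -> V) (pdeg : V -> nat) (hF : is_portrait d Y Z pF pdeg)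
  (TX : sphereTree Sph X) (TY : sphereTree Sph Y) (TZ : sphereTree Sph Z)
  (F : V -> V) (f : forall v, Sph v -> Sph (F v))
  (hbd : in_bdRatFX d pF pdeg TX TY TZ f)
  (v : V) (hv : periodic_vertex TX F v)
  (t0 : Sph v)
  (hB : forall k, branch_maps_inside TY TZ f (fiter f k t0)) :
  (forall v', [set v'] \in branch TY t0 ->
     ~ (critical_vertex pdeg TY f v' /\ periodic_vertex TX F v')) /\
  (forall v', [set v'] \in branch TY t0 -> periodic_vertex TX F v' ->
     (forall p, exact_period F v' p -> cover_degree (fiter f p (v := v')) 1) /\
     periodic_point f t0).
Proof.
have [dyn [fs [ys [zs [rat [phiY [phiZ [cvY cvZ cvf _]]]]]]]] := hbd.
have XY : X \subset Y by apply: (fintype.subset_trans hXYZ); exact: finset.subsetIl.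
have XZ : X \subset Z by apply: (fintype.subset_trans hXYZ); exact: finset.subsetIr.
have cover : is_cover TY TZ f by case: dyn.
have iXYZ u : u \in internal TX -> u \in internal TY /\ u \in internal TZ.
  exact: (intXYZ dyn).
have iterX u k : periodic_vertex TX F u -> iter k F u \in internal TX.
  case=> uX uT _; elim: k => [//|k IH]; have [kY _] := iXYZ _ IH.
  have := cover_internal cover kY; rewrite !inE => /andP[kZ _].
  by rewrite (uT k.+1) andbT; apply: contra kZ => /(fintype.subsetP XZ).
have key v' : [set v'] \in branch TY t0 -> periodic_vertex TX F v' ->
    (forall k, bijection (@f (iter k F v'))) /\ periodic_point f t0.
  move=> v'B hv'.
  have follow k : iter k F v' != iter k F v /\
      attpt TY (iter k F v) (iter k F v') = fiter f k t0.
    elim: k => [|k [ne Ek]].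
      have [vY _] := iXYZ _ (iterX v 0 hv).
      by have [_ ne E] := (branch_vertP _ _ (internal_vert vY)).1 v'B.
    have vX := iterX v k hv; have [vY _] := iXYZ _ vX.
    have v'X := iterX v' k hv'; have [v'Y _] := iXYZ _ v'X.
    have vX1 := iterX v k.+1 hv; have [_ vZ1] := iXYZ _ vX1.
    have v'X1 := iterX v' k.+1 hv'.
    have kB : [set iter k F v'] \in branch TY (fiter f k t0).
      by apply/(branch_vertP _ _ (internal_vert vY)); split => //; exact: internal_vert.
    have := @hB k _ kB; rewrite imset_set1.
    move=> /(branch_vertP _ _ (internal_vert vZ1)) [_ ne1 E1]; split => //.
    rewrite -(direction_agrees XY XZ (intXYZ dyn) (attXYZ dyn) vX1 v'X1) //.
    by rewrite eq_sym.
  have [mk mkP] := marks_choice XY dyn.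
  pose rho k := ratio zs (mk (iter k F v, iter k F v')).
  have mkk k : marks TX TY (iter k F v) (iter k F v') (mk (iter k F v, iter k F v')).
    by apply: mkP; [exact: iterX|exact: iterX|rewrite eq_sym; case: (follow k)].
  have turn k : @f _ (attpt TY (iter k F v) (iter k F v')) =
      attpt TY (iter k.+1 F v) (iter k.+1 F v').
    by rewrite (follow k.+1).2 (follow k).2.
  have inside k : branch_maps_inside TY TZ f (attpt TY (iter k F v) (iter k F v')).
    by rewrite (follow k).2; exact: hB.
  have step k := scale_step hd XY XZ hF dyn rat cvY cvZ cvf (iterX v k hv)
    (iterX v' k hv') (iterX v k.+1 hv) (iterX v' k.+1 hv') (mkk k) (mkk k.+1)
    (turn k) (inside k).
  have [p [p0 vp v'p]] : exists p, [/\ 0 < p, iter p F v = v & iter p F v' = v'].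
    have [_ _ [p p0 vp]] := hv; have [_ _ [p' p'0 v'p]] := hv'.
    exists (p * p'); split; first by rewrite muln_gt0 p0.
      by rewrite mulnC iterM iter_fix.
    by rewrite iterM iter_fix.
  have per (u : V) k : iter p F u = u -> iter (k + p) F u = iter k F u.
    by move=> up; rewrite iterD up.
  split.
    move=> k; apply: in_coord_bijection; case: (step k) => _ [//|quad].
    have := @cyclic_scales R rho p p0 _ _ _ (fun j => (step j).1) k quad; case.
    - by move=> j; rewrite /rho (per v j vp) (per v' j v'p).
    - by move=> j n; exact: (ratio_neq0 XZ rat n (mkk j)).
    - by move=> j; exact: (ratio_cvg0 XY dyn rat cvY (iterX v j hv) (mkk j)).
  exists p => //; rewrite -(follow p).2 vp v'p.
  by rewrite (follow 0).2.
split=> v' v'B.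
  case=> -[[v'Y [m m2 deg]]|[v'Y _]] hv'.
    have [bij _] := key v' v'B hv'.
    by have := bijection_degree_unique (bij 0) deg => m1; rewrite m1 in m2.
  have [v'X _ _] := hv'; have [v'I _] := iXYZ _ v'X.
  by move: v'I; rewrite inE v'Y.
move=> hv'; have [bij per] := key v' v'B hv'; split => // p _.
apply: bijection_degree; elim: p => [|p [inj surj]] /=.
  by split => [a b|s] //; exists s.
have [inj1 surj1] := bij p; split=> [a b /inj1 /inj //|s].
by have [t <-] := surj1 s; have [r <-] := surj t; exists r.
Qed.
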